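(* Let $H$ be a separable complex Hilbert space, let $A\in\mathcal{B}(H)$, and let $X\in\mathcal{B}_p(H)$ with $2\le p<\infty$ and $X$ accretive. Then $$w_p(AX)\le\sqrt{1+2^{1-2/p}}\;\|A\|\,w_p(X).$$ Moreover, if $X$ is accretive and dissipative, then $$w_p(AX)\le\sqrt2\,\|A\|\,w_p(X).$$
   Context: $\mathcal{B}(H)$ is the space of bounded operators on $H$ with operator norm $\|\cdot\|$. $\mathcal{B}_p(H)$ is the $p$-Schatten class: the compact operators $T$ on $H$ with $\|T\|_p=(\mathrm{tr}|T|^p)^{1/p}<\infty$. For $T\in\mathcal{B}(H)$, $Re(T)=\frac{T+T^*}{2}$ and $Im(T)=\frac{T-T^*}{2i}$; $T$ is accretive if $Re(T)\ge0$ and dissipative if $Im(T)\ge0$. For $T\in\mathcal{B}_p(H)$, $w_p(T)=\sup_{\theta\in\mathbb{R}}\|Re(e^{i\theta}T)\|_p$. *)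

(* Defs.v *)
From HB Require Import structures.
From mathcomp Require Import all_boot all_order all_algebra.
From mathcomp Require Import complex.
From mathcomp Require Import all_classical all_reals all_analysis.
Import Order.TTheory GRing.Theory Num.Theory.
Import numFieldNormedType.Exports.

Set Implicit Arguments.
Unset Strict Implicit.
Unset Printing Implicit Defensive.

Local Open Scope classical_set_scope.
Local Open Scope ring_scope.

(* The inner product is linear in its first argument and conjugate-linear in
   the second. *)
HB.mixin Record CompleteNormedModule_isHilbert (R : realType) H
    of CompleteNormedModule R[i] H := {
  inner : {dot H for Num.conj};
  inner_norm : forall x : H, inner x x = `|x| ^+ 2
}.

#[short(type="hilbertType")]
HB.structure Definition Hilbert (R : realType) :=
  { H of CompleteNormedModule_isHilbert R H & CompleteNormedModule R[i] H }.

Definition separable {T : topologicalType} : Prop :=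
  exists D : set T, countable D /\ dense D.
Arguments separable T : clear implicits.

Section Operators.
Context {R : realType} {H : hilbertType R}.
Implicit Types (T S P : H -> H) (x y : H) (p : R).

Definition bounded_operator T : Prop :=
  linear T /\ exists M : R[i], forall x, `|T x| <= M * `|x|.

Definition compact_operator T : Prop :=
  linear T /\ precompact (T @` [set x | `|x| <= 1]).

(* Norms in H are elements of R[i] with zero imaginary part. *)
Definition operator_norm T : R :=
  sup [set complex.Re `|T x| | x in [set x | `|x| <= 1]].

Definition adjoint T : H -> H :=
  xget (fun=> 0) [set S : H -> H | forall x y, inner (T x) y = inner x (S y)].

Definition re_operator T : H -> H :=
  fun x => 2^-1 *: (T x + adjoint T x).

Definition im_operator T : H -> H :=
  fun x => (2 * 'i%C)^-1 *: (T x - adjoint T x).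

(* In R[i], [0 <= z] means that z is real and nonnegative. *)
Definition positive_operator T : Prop := forall x, 0 <= inner (T x) x.

Definition accretive T : Prop := positive_operator (re_operator T).

Definition dissipative T : Prop := positive_operator (im_operator T).

(* |T|, the positive square root of T^* T *)
Definition modulus T : H -> H :=
  xget (fun=> 0) [set S : H -> H | [/\ bounded_operator S,
    positive_operator S & forall x, S (S x) = adjoint T (T x)]].

(* S^p for p > 0 and S compact and positive: the bounded operator acting as
   l^p on the eigenspace of S for each l (it is unique, since by the spectral
   theorem these eigenspaces span a dense subspace of H). *)
Definition operator_power S p : H -> H :=
  xget (fun=> 0) [set P : H -> H | bounded_operator P /\
    forall (l : R) x, 0 <= l -> S x = l%:C%C *: x -> P x = (l `^ p)%:C%C *: x].

Definition orthonormal_basis (B : set H) : Prop :=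
  (forall e f, B e -> B f -> inner e f = (e == f)%:R) /\
  (forall x, (forall e, B e -> inner x e = 0) -> x = 0).

(* The trace of a positive operator, with values in [0, +oo]; it does not
   depend on the choice of the orthonormal basis. *)
Definition trace P : \bar R :=
  (\esum_(e in xget set0 orthonormal_basis) (complex.Re (inner (P e) e))%:E)%E.

(* Meaningful for compact T, where it lies in [0, +oo]. *)
Definition schatten_norm p T : \bar R :=
  (trace (operator_power (modulus T) p) `^ p^-1)%E.

Definition schatten_class p T : Prop :=
  [/\ bounded_operator T, compact_operator T & (schatten_norm p T < +oo)%E].

Definition expi (t : R) : R[i] := (cos t +i* sin t)%C.

Definition schatten_numerical_radius p T : \bar R :=
  ereal_sup [set schatten_norm p (re_operator (fun x => expi t *: T x))
            | t in [set: R]].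

End Operators.

(* Main.v *)
(* For [p >= 2] the norm [|K|_p^p] is the supremum of [\sum |K e|^p] over the
   orthonormal families [e] (Jensen), attained at an eigenbasis of [K^* K]. At an
   eigenbasis of [Re (c A X)], [|c| = 1], one has
   [|Re (c A X) e| = |Re <c A X e, e>| <= |A| |X e|], hence
   [w_p (A X) <= |A| |X|_p], and it remains to bound [|X|_p] by [w_p X].

   If [X = P + i S] is accretive and dissipative, positivity of the forms of [P]
   and [S] gives [Re <X e, f> <= (<(P + S) e, e> + <(P + S) f, f>) / 2] where
   [P + S = sqrt 2 Re (c X)], [c = exp (- i pi / 4)]; take for [e] and [f] the
   right and left singular vectors of [X].

   If [X] is only accretive, let [E] be the span of the first [k] right singular
   vectors. The parallelogram law on the orthogonal of [E] bounds the sum of the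
   [k] largest [s_j(X)^2] by the sum, over [K = P] and [K = S], of the squared
   Hilbert-Schmidt norms of [K] minus its compression to the orthogonal of [E].
   The first is at most the sum of the [k] largest [s_j(P)^2] as [P] is positive,
   and the second at most the sum of the [2 k] largest [s_j(S)^2]. Summation by
   parts against the weights [s_j(X)^(p - 2)] and Young's inequality turn this
   weak majorisation into [|X|_p^2 <= (1 + 2^(1 - 2 / p)) w^2] when [|P|_p] and
   [|S|_p] are at most [w]. *)

Require Import Defs.
From mathcomp Require Import all_boot all_order all_algebra.
From mathcomp Require Import complex ring lra.
From mathcomp Require Import all_classical all_reals all_analysis.
Import Order.TTheory GRing.Theory Num.Theory.
Import numFieldNormedType.Exports.
Local Open Scope ring_scope.

Set Implicit Arguments.
Unset Strict Implicit.
Unset Printing Implicit Defensive.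
Local Open Scope classical_set_scope.

Local Notation Re := complex.Re.
Local Notation Im := complex.Im.

(** * Real and imaginary parts, squared modulus *)

Section ComplexNumbers.
Context {R : realType}.
Implicit Types (z w : R[i]) (a : R).

(** The squared modulus with values in [R] rather than [R[i]], within reach of real arithmetic. *)
Definition csq z : R := Re z ^+ 2 + Im z ^+ 2.

Lemma csq_ge0 z : 0 <= csq z.
Proof. by rewrite addr_ge0 ?sqr_ge0. Qed.

Lemma csq0 : csq 0 = 0.
Proof. by rewrite /csq /= expr0n addr0. Qed.

Lemma csq_eq0 z : csq z = 0 -> z = 0.
Proof.
case: z => a b; rewrite /csq /= => /eqP.
by rewrite paddr_eq0 ?sqr_ge0 // !sqrf_eq0 => /andP[/eqP-> /eqP->].
Qed.

Lemma ReM z w : Re (z * w) = Re z * Re w - Im z * Im w.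
Proof. by case: z; case: w. Qed.

Lemma ImM z w : Im (z * w) = Re z * Im w + Im z * Re w.
Proof. by case: z; case: w. Qed.

Lemma ReD z w : Re (z + w) = Re z + Re w.
Proof. by case: z; case: w. Qed.

Lemma ImD z w : Im (z + w) = Im z + Im w.
Proof. by case: z; case: w. Qed.

Lemma ReN z : Re (- z) = - Re z. Proof. by case: z. Qed.
Lemma ImN z : Im (- z) = - Im z. Proof. by case: z. Qed.

Lemma ReJ z : Re z^* = Re z. Proof. by case: z. Qed.
Lemma ImJ z : Im z^* = - Im z. Proof. by case: z. Qed.

Lemma conjCR a : (a%:C%C : R[i])^* = a%:C%C. Proof. exact: conjc_real. Qed.

Lemma Re_sum I (r : seq I) (P : pred I) (F : I -> R[i]) :
  Re (\sum_(i <- r | P i) F i) = \sum_(i <- r | P i) Re (F i).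
Proof. by elim/big_rec2: _ => // i y x _ <-; rewrite ReD. Qed.

Definition reimE := (ReM, ImM, ReD, ImD, ReN, ImN, ReJ, ImJ).

Lemma csqJ z : csq z^* = csq z.
Proof. by rewrite /csq !reimE sqrrN. Qed.

Lemma csqN z : csq (- z) = csq z.
Proof. by rewrite /csq !reimE !sqrrN. Qed.

Lemma csqM z w : csq (z * w) = csq z * csq w.
Proof. by rewrite /csq !reimE; ring. Qed.

Lemma csqR a : csq a%:C%C = a ^+ 2.
Proof. by rewrite /csq /= expr0n addr0. Qed.

Lemma csqE z : z * z^* = (csq z)%:C%C.
Proof. by case: z => a b; rewrite /csq; apply/eqP; rewrite eq_complex /=; apply/andP; split; apply/eqP; ring. Qed.

Lemma csqD_le z w : csq (z + w) <= 2 * csq z + 2 * csq w.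
Proof.
rewrite /csq !reimE.
by have := sqr_ge0 (Re z - Re w); have := sqr_ge0 (Im z - Im w); nra.
Qed.

Lemma eqC z w : Re z = Re w -> Im z = Im w -> z = w.
Proof. by case: z; case: w => a b c d /= -> ->. Qed.

Lemma realC_Im0 z : Im z = 0 -> z = (Re z)%:C%C.
Proof. by case: z => a b /= ->. Qed.

Lemma csq_sqrRe z : Re z ^+ 2 <= csq z.
Proof. by rewrite lerDl sqr_ge0. Qed.

End ComplexNumbers.

(** * Hilbert spaces *)

Section InnerProduct.
Context {R : realType} {H : hilbertType R}.
Implicit Types (x y z : H) (a b : R[i]).

Lemma innerDl x y z : inner (x + y) z = inner x z + inner y z.
Proof. by rewrite linearDl. Qed.

Lemma innerZl a x z : inner (a *: x) z = a * inner x z.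
Proof. by rewrite linearZl_LR. Qed.

Lemma innerJ x y : inner y x = (inner x y)^*.
Proof. by have := @hermC _ false Num.conj H inner y x; rewrite expr0 mul1r. Qed.

Lemma innerDr x y z : inner z (x + y) = inner z x + inner z y.
Proof. by rewrite linearDr. Qed.

Lemma innerZr a x z : inner z (a *: x) = a^* * inner z x.
Proof. by rewrite linearZr_LR. Qed.

Lemma inner0l x : inner 0 x = 0. Proof. by rewrite linear0l. Qed.
Lemma inner0r x : inner x 0 = 0. Proof. by rewrite linear0r. Qed.

Lemma innerNl x z : inner (- x) z = - inner x z.
Proof. by rewrite linearNl. Qed.

Lemma innerNr x z : inner z (- x) = - inner z x.
Proof. by rewrite linearNr. Qed.

Lemma innerBl x y z : inner (x - y) z = inner x z - inner y z.
Proof. by rewrite innerDl innerNl. Qed.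

Lemma innerBr x y z : inner z (x - y) = inner z x - inner z y.
Proof. by rewrite innerDr innerNr. Qed.

Lemma inner_suml I (r : seq I) (P : pred I) (F : I -> H) z :
  inner (\sum_(i <- r | P i) F i) z = \sum_(i <- r | P i) inner (F i) z.
Proof. by elim/big_rec2: _ => [|i y x _ <-]; rewrite ?inner0l // innerDl. Qed.

Lemma inner_sumr I (r : seq I) (P : pred I) (F : I -> H) z :
  inner z (\sum_(i <- r | P i) F i) = \sum_(i <- r | P i) inner z (F i).
Proof. by elim/big_rec2: _ => [|i y x _ <-]; rewrite ?inner0r // innerDr. Qed.

Definition innerE := (innerDl, innerDr, innerNl, innerNr, innerZl, innerZr).

Lemma csq_innerC x y : csq (inner y x) = csq (inner x y).
Proof. by rewrite innerJ csqJ. Qed.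

(** Squared norm and norm as elements of [R]. Estimates mostly use [nsq], which expands by
    sesquilinearity. *)
Definition nsq x : R := Re (inner x x).
Definition nr x : R := Re `|x|.

Lemma inner_nsq x : inner x x = (nsq x)%:C%C.
Proof.
rewrite /nsq; apply: realC_Im0; have := congr1 (@complex.Im R) (innerJ x x).
by rewrite ImJ => h; lra.
Qed.

Lemma norm_nr x : `|x| = (nr x)%:C%C.
Proof. by rewrite /nr; apply: realC_Im0; have := normr_ge0 x; rewrite lecE => /andP[/eqP]. Qed.

Lemma nr_ge0 x : 0 <= nr x.
Proof. by have := normr_ge0 x; rewrite norm_nr lecR. Qed.

Lemma nsqE x : nsq x = nr x ^+ 2.
Proof. by rewrite /nsq inner_norm norm_nr -rmorphXn. Qed.

Lemma nsq_ge0 x : 0 <= nsq x. Proof. by rewrite nsqE sqr_ge0. Qed.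

Lemma nsq_eq0 x : nsq x = 0 -> x = 0.
Proof.
rewrite nsqE => /eqP; rewrite sqrf_eq0 => /eqP h; apply/eqP.
by rewrite -normr_eq0 norm_nr h.
Qed.

Lemma nsq0 : nsq 0 = 0. Proof. by rewrite /nsq inner0l. Qed.

Lemma nsqD x y : nsq (x + y) = nsq x + nsq y + 2 * Re (inner x y).
Proof. by rewrite /nsq !innerE (innerJ x y) !reimE; ring. Qed.

Lemma nsqN x : nsq (- x) = nsq x.
Proof. by rewrite /nsq !innerE opprK. Qed.

Lemma nsqB x y : nsq (x - y) = nsq x + nsq y - 2 * Re (inner x y).
Proof. by rewrite nsqD nsqN innerNr !reimE; ring. Qed.

Lemma nsqZ a x : nsq (a *: x) = csq a * nsq x.
Proof. by rewrite /nsq !innerE mulrA csqE inner_nsq !reimE /=; ring. Qed.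

Lemma nsqD_le x y : nsq (x + y) <= 2 * nsq x + 2 * nsq y.
Proof. by have := nsq_ge0 (x - y); rewrite nsqB nsqD; lra. Qed.

(** Expands the squared norm of [|y|^2 x - <x, y> y] and cancels one factor [|y|^2]. *)
Lemma cauchy_schwarz x y : csq (inner x y) <= nsq x * nsq y.
Proof.
have [y0|y0] := eqVneq (nsq y) 0.
  by rewrite (nsq_eq0 y0) inner0r csq0 nsq0 mulr0.
have yp : 0 < nsq y by rewrite lt0r y0 nsq_ge0.
have := nsq_ge0 ((nsq y)%:C%C *: x - inner x y *: y).
rewrite nsqB !nsqZ !innerE csqR.
rewrite [_^* * _]mulrC csqE.
rewrite !reimE /= => h.
have : 0 <= nsq y * (nsq x * nsq y - csq (inner x y)) by lra.
by rewrite pmulr_rge0 // subr_ge0.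
Qed.

Lemma nr_sqrt x : nr x = Num.sqrt (nsq x).
Proof. by rewrite nsqE sqrtr_sqr ger0_norm ?nr_ge0. Qed.

Lemma Re_inner_le x y : `|Re (inner x y)| <= nr x * nr y.
Proof.
rewrite !nr_sqrt -sqrtrM ?nsq_ge0 // -sqrtr_sqr ler_wsqrtr //.
exact: le_trans (csq_sqrRe _) (cauchy_schwarz _ _).
Qed.

Lemma nr0 : nr 0 = 0.
Proof. by rewrite nr_sqrt nsq0 sqrtr0. Qed.

End InnerProduct.

(** * Finite orthonormal families *)

Section Orthonormal.
Context {R : realType} {H : hilbertType R}.
Implicit Types (x y z b e f : H) (a : R[i]) (s : seq H) (B : set H) (c : H -> R[i]).

(** The second clause compares vectors, not positions, so [uniq] has to exclude repetitions. *)
Definition ons s : Prop :=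
  uniq s /\ forall e f, e \in s -> f \in s -> inner e f = (e == f)%:R.

(** For [c = inner x] and [s] orthonormal, this is the orthogonal projection of [x] on the span of
    [s]. *)
Definition fsum s c : H := \sum_(b <- s) c b *: b.

Lemma ons_sub s s' : uniq s' -> {subset s' <= s} -> ons s -> ons s'.
Proof. by move=> us ss [_ os]; split=> // e f /ss es /ss fs; apply: os. Qed.

Lemma nsq_ons s b : ons s -> b \in s -> nsq b = 1.
Proof. by move=> [_ os] bs; rewrite /nsq os // eqxx. Qed.

Lemma inner_fsum s c b : ons s -> b \in s -> inner (fsum s c) b = c b.
Proof.
move=> [us os] bs; rewrite inner_suml (bigD1_seq b) //= innerZl os // eqxx mulr1.
rewrite big_seq_cond big1 ?addr0 // => f /andP[fs fb].
by rewrite innerZl os // (negbTE fb) mulr0.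
Qed.

Lemma nsq_fsum s c : ons s -> nsq (fsum s c) = \sum_(b <- s) csq (c b).
Proof.
move=> os; rewrite /nsq [X in inner _ X]/fsum inner_sumr Re_sum.
rewrite big_seq [RHS]big_seq; apply: eq_bigr => b bs.
by rewrite innerZr inner_fsum // mulrC csqE.
Qed.

Lemma Re_inner_fsumr s x : Re (inner x (fsum s (inner x))) =
  \sum_(b <- s) csq (inner x b).
Proof.
rewrite /fsum inner_sumr Re_sum; apply: eq_bigr => b _.
by rewrite innerZr mulrC csqE.
Qed.

Lemma nsq_fsumB s x : ons s ->
  nsq (x - fsum s (inner x)) = nsq x - \sum_(b <- s) csq (inner x b).
Proof. by move=> os; rewrite nsqB nsq_fsum // Re_inner_fsumr; ring. Qed.

Lemma bessel s x : ons s -> \sum_(b <- s) csq (inner x b) <= nsq x.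
Proof. by move=> os; rewrite -subr_ge0 -nsq_fsumB // nsq_ge0. Qed.

Lemma inner_fsumB s x b : ons s -> b \in s ->
  inner (x - fsum s (inner x)) b = 0.
Proof. by move=> os bs; rewrite innerBl inner_fsum // subrr. Qed.

Lemma ons_rcons s x : ons s -> nsq x = 1 -> (forall b, b \in s -> inner x b = 0) ->
  ons (rcons s x).
Proof.
move=> [us os] x1 xs; split.
  rewrite rcons_uniq us andbT; apply/negP => /xs.
  by rewrite inner_nsq x1 => /(congr1 (@complex.Re R)) /eqP; rewrite /= oner_eq0.
move=> e f; rewrite !mem_rcons !inE => /predU1P[->|es] /predU1P[->|fs].
- by rewrite eqxx inner_nsq x1.
- rewrite xs //; case: eqP => // xf; move: (xs f fs); rewrite -xf inner_nsq x1.
  by move/(congr1 (@complex.Re R)) => /eqP; rewrite /= oner_eq0.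
- rewrite innerJ xs // rmorph0; case: eqP => // xf; move: (xs e es).
  by rewrite xf inner_nsq x1 => /(congr1 (@complex.Re R)) /eqP; rewrite /= oner_eq0.
- exact: os.
Qed.

Definition unit_of x : H := ((nr x)^-1)%:C%C *: x.

Lemma nsq_unit_of x : nsq x != 0 -> nsq (unit_of x) = 1.
Proof.
move=> x0; rewrite nsqZ csqR nsqE exprVn mulVf //.
by rewrite -nsqE.
Qed.

(** Each vector of [v] contributes its normalised residual, unless the residual vanishes. The bound
    on the size of [g] later limits the number of vectors in Ky Fan sums. *)
Lemma gram_schmidt s (v : seq H) : ons s ->
  exists g : seq H, [/\ ons (s ++ g), (size g <= size v)%N &
    forall x, x \in v -> x = fsum (s ++ g) (inner x)].
Proof.
move=> os; elim: v => [|x v [g [og sg vg]]].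
  by exists [::]; rewrite cats0.
set u := x - fsum (s ++ g) (inner x).
have [u0|u0] := eqVneq (nsq u) 0.
  exists g; split=> [//| |y]; first exact: leq_trans sg _.
  rewrite inE => /predU1P[->|/vg//].
  by apply/eqP; rewrite -subr_eq0; apply/eqP/nsq_eq0.
have ou : ons (rcons (s ++ g) (unit_of u)).
  apply: ons_rcons => //; first exact: nsq_unit_of.
  by move=> b bs; rewrite innerZl inner_fsumB // mulr0.
exists (rcons g (unit_of u)); rewrite -rcons_cat; split=> //.
  by rewrite size_rcons.
have fsr c : fsum (rcons (s ++ g) (unit_of u)) c =
    fsum (s ++ g) c + c (unit_of u) *: unit_of u.
  by rewrite /fsum -cats1 big_cat big_seq1.
move=> y; rewrite inE => /predU1P[->|yv]; rewrite fsr; last first.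
  have -> : inner y (unit_of u) = 0; last by rewrite scale0r addr0 -vg.
  rewrite (vg y yv) inner_suml big_seq big1 // => b bs.
  by rewrite innerZl innerZr [inner b u]innerJ inner_fsumB // rmorph0 !mulr0.
(* The projection already subtracted is orthogonal to [u], so the new coefficient is the norm of the
   residual. *)
have -> : inner x (unit_of u) = (nr u)%:C%C.
  have xu : inner (fsum (s ++ g) (inner x)) u = 0.
    rewrite inner_suml big_seq big1 // => b bs.
    by rewrite innerZl [inner b u]innerJ inner_fsumB // rmorph0 mulr0.
  rewrite innerZr -[X in inner X u](subrK (fsum (s ++ g) (inner x))) -/u.
  rewrite innerDl xu addr0 inner_nsq nsqE conjCR -rmorphM; congr (_%:C%C).
  rewrite expr2 mulrA mulVf ?mul1r //.
  by apply: contraNneq u0 => u0; rewrite nsqE u0 expr0n.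
rewrite /unit_of scalerA -rmorphM mulfV ?scale1r 1?addrC ?subrK //.
by apply: contraNneq u0 => u0; rewrite nsqE u0 expr0n.
Qed.

End Orthonormal.

(** * Completeness, Riesz-Fischer theorem and maximal orthonormal sets *)

Section Completeness.
Context {R : realType} {H : hilbertType R}.
Implicit Types (x y : H) (s t : seq H) (B : set H) (c : H -> R[i]) (M e : R).

Lemma nsq_ltP x e : 0 < e -> (`|x| < e%:C%C) = (nsq x < e ^+ 2).
Proof. by move=> e0; rewrite norm_nr ltcR nsqE ltr_pXn2r // nnegrE ?nr_ge0 // ltW. Qed.

Lemma cvg_nsqP (F : set_system H) (FF : Filter F) y :
  F --> y <-> forall e, 0 < e -> F [set x | nsq (x - y) < e].
Proof.
rewrite fcvgrPdist_lt; split=> [h e e0|h].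
  have se : 0 < Num.sqrt e by rewrite sqrtr_gt0.
  have := h (Num.sqrt e)%:C%C; rewrite ltcR => /(_ se); apply: filterS => x.
  by rewrite distrC nsq_ltP // sqr_sqrtr // ltW.
case=> e i; rewrite ltcE /= => /andP[/eqP -> e0].
apply: filterS (h (e ^+ 2) (exprn_gt0 _ e0)) => x /=.
by rewrite distrC nsq_ltP.
Qed.

Lemma complete_nsq (F : set_system H) (FF : ProperFilter F) :
  (forall e, 0 < e -> exists x, F [set y | nsq (y - x) < e]) -> exists y, F --> y.
Proof.
move=> h; suff : cvg F by move/cvg_ex.
apply/cauchy_cvgP/cauchyP; case=> e i; rewrite ltcE /= => /andP[/eqP -> e0].
have [x Fx] := h (e ^+ 2) (exprn_gt0 _ e0); exists x.
apply: filterS Fx => y /=; rewrite -ball_normE /=.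
by rewrite distrC nsq_ltP.
Qed.

Definition orthonormal_set B :=
  forall x y, B x -> B y -> inner x y = (x == y)%:R.

Definition fam B s : Prop := uniq s /\ forall b, b \in s -> B b.

Lemma ons_fam B s : orthonormal_set B -> fam B s -> ons s.
Proof. by move=> oB [us sB]; split=> // e f /sB Be /sB Bf; apply: oB. Qed.

Lemma fam_undup B s t : fam B s -> fam B t -> fam B (undup (s ++ t)).
Proof.
move=> [_ sB] [_ tB]; split; first exact: undup_uniq.
by move=> b; rewrite mem_undup mem_cat => /orP[/sB|/tB].
Qed.

Lemma big_sub_uniq (V : nmodType) (f : H -> V) s t : uniq s -> uniq t ->
  {subset s <= t} ->
  \sum_(b <- t) f b = \sum_(b <- s) f b + \sum_(b <- t | b \notin s) f b.
Proof.
move=> us ut st; rewrite (bigID (mem s)) /=; congr (_ + _).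
rewrite -big_filter; apply: perm_big; apply: uniq_perm => //.
  exact: filter_uniq.
by move=> b; rewrite mem_filter; case: (boolP (b \in s)) => // /st ->.
Qed.

Lemma nsq_fsum_diff B s t c : orthonormal_set B -> fam B s -> fam B t ->
  {subset s <= t} ->
  nsq (fsum t c - fsum s c) = \sum_(b <- t) csq (c b) - \sum_(b <- s) csq (c b).
Proof.
move=> oB fs ft st; have [us _] := fs; have [ut tB] := ft.
rewrite /fsum !(big_sub_uniq _ us ut st) [in LHS]addrAC [in RHS]addrAC !subrr !add0r.
rewrite -big_filter -[RHS]big_filter -/(fsum _ _) nsq_fsum //; apply: (ons_fam oB); split.
  exact: filter_uniq.
by move=> b; rewrite mem_filter => /andP[_ /tB].
Qed.

(** The finite sums whose square sum is within [e] of the supremum generate a Cauchy filter; its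
    limit has the prescribed coefficients. *)
Lemma riesz_fischer B c M : orthonormal_set B ->
  (forall s, fam B s -> \sum_(b <- s) csq (c b) <= M) ->
  exists y, (forall b, B b -> inner y b = c b) /\
    forall e, 0 < e -> exists2 s, fam B s & nsq (y - fsum s c) < e.
Proof.
move=> oB hM.
pose S := [set v | exists2 s, fam B s & v = \sum_(b <- s) csq (c b)].
have S0 : has_sup S.
  split; first by exists 0; exists [::]; rewrite ?big_nil //; split.
  by exists M => _ [s fs ->]; apply: hM.
pose D e := [set y | exists s, [/\ fam B s, y = fsum s c &
                       sup S - e < \sum_(b <- s) csq (c b)]].
have Dn e : 0 < e -> D e !=set0.
  move=> e0; have [_ [s fs ->] h] := sup_adherent e0 S0.
  by exists (fsum s c), s.
have FF : ProperFilter (filter_from [set e : R | 0 < e] D).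
  apply: filter_from_proper => //; apply: filter_from_filter; first by exists 1 => /=.
  move=> e f /= e0 f0; exists (Num.min e f); first by rewrite /= lt_min e0.
  move=> _ [s [fs -> h]]; split; exists s; split=> //; apply: le_lt_trans h;
    by rewrite lerB // ge_min lexx ?orbT.
have near e s t : fam B s -> fam B t -> sup S - e < \sum_(b <- s) csq (c b) ->
    {subset s <= t} -> nsq (fsum t c - fsum s c) < e.
  move=> fs ft h st; rewrite (nsq_fsum_diff _ oB) //.
  have : \sum_(b <- t) csq (c b) <= sup S by apply: ub_le_sup; [case: S0|exists t].
  by lra.
have [e e0|y /cvg_nsqP Fy] := complete_nsq FF.
  have e4 : 0 < e / 4 by lra.
  have [_ [s [fs _ hs]]] := Dn _ e4; exists (fsum s c).
  exists (e / 4) => // y [t [ft yE ht]] /=; rewrite {y}yE.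
  (* Two almost maximal families are compared through their union. *)
  have fu := fam_undup fs ft.
  have h1 := near _ _ _ fs fu hs _; have h2 := near _ _ _ ft fu ht _.
  have := nsqD_le (fsum t c - fsum (undup (s ++ t)) c)
     (fsum (undup (s ++ t)) c - fsum s c).
  rewrite subrKA -[X in _ <= 2 * X + _]nsqN opprB.
  have k1 : nsq (fsum (undup (s ++ t)) c - fsum s c) < e / 4.
    by apply: h1 => b bs; rewrite mem_undup mem_cat bs.
  have k2 : nsq (fsum (undup (s ++ t)) c - fsum t c) < e / 4.
    by apply: h2 => b bs; rewrite mem_undup mem_cat bs orbT.
  by rewrite /=; lra.
exists y; split=> [b Bb|e e0]; last first.
  have [d /= d0 dF] := Fy e e0; have [_ [s [fs _ hs]]] := Dn _ d0.
  exists s => //; rewrite -nsqN opprB.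
  by have := dF (fsum s c); apply; exists s.
have b1 : nsq b = 1 by rewrite /nsq oB // eqxx.
apply/eqP; rewrite -subr_eq0; apply/eqP/csq_eq0/eqP.
rewrite eq_le csq_ge0 andbT; apply/ler_addgt0Pr => e e0; rewrite add0r.
have e4 : 0 < e / 4 by lra.
have [d /= d0 dF] := Fy _ e4.
have m0 : 0 < Num.min d (e / 4) by rewrite lt_min d0.
have [_ [s [fs _ hs]]] := Dn _ m0.
have k1 : nsq (fsum s c - y) < e / 4.
  apply: (dF (fsum s c)); exists s; split=> //.
  by apply: le_lt_trans hs; rewrite lerB // ge_min lexx.
have k2 : csq (inner (fsum s c) b - c b) <= e / 4.
  have [bs|bs] := boolP (b \in s).
    by rewrite (inner_fsum _ (ons_fam oB fs)) // subrr csq0 ltW.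
  have -> : inner (fsum s c) b = 0.
    rewrite inner_suml big_seq big1 // => f fs'; have [_ sB] := fs.
    rewrite innerZl oB //; last exact: sB.
    by case: eqP fs' bs => [->->|] //; rewrite mulr0.
  (* A vector missing from an almost maximal family has a small coefficient, since adding it cannot
     exceed the supremum. *)
  rewrite sub0r csqN; have fb : fam B (b :: s).
    have [us sB] := fs; split; first by rewrite /= bs.
    by move=> f; rewrite inE => /predU1P[->|/sB].
  have : \sum_(f <- b :: s) csq (c f) <= sup S.
    by apply: ub_le_sup; [case: S0|exists (b :: s)].
  rewrite big_cons; have : Num.min d (e / 4) <= e / 4 by rewrite ge_min lexx orbT.
  by lra.
have -> : inner y b - c b = - inner (fsum s c - y) b + (inner (fsum s c) b - c b).
  by rewrite innerBl; ring.
apply: le_trans (csqD_le _ _) _; rewrite csqN.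
have := cauchy_schwarz (fsum s c - y) b; rewrite b1 mulr1.
by lra.
Qed.

(** Zorn's lemma. Taking everything for [Q] yields bases; taking the eigenvectors of an operator
    yields the spectral theorem. *)
Lemma maximal_orthonormal (Q : set H) : exists B,
  [/\ orthonormal_set B, B `<=` Q &
   forall x, Q x -> nsq x = 1 -> ~ (forall b, B b -> inner x b = 0)].
Proof.
have [|B [[oB BQ] mB]] := @Zorn_bigcup H [set B | orthonormal_set B /\ B `<=` Q].
  move=> F FP tF; split; last by move=> x [X /FP[_ XQ] /XQ].
  move=> e f [X FX Xe] [Y FY Yf]; have [XY|YX] := tF X Y FX FY.
    by have [oY _] := FP Y FY; apply: oY => //; apply: XY.
  by have [oX _] := FP X FX; apply: oX => //; apply: YX.
exists B; split=> // x Qx x1 xB.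
apply: (mB (B `|` [set x])); first split.
- by move=> b Bb; left.
- move=> h; have Bx : B x by apply: h; right.
  move: (xB x Bx); rewrite inner_nsq x1 => /(congr1 (@complex.Re R)) /eqP.
  by rewrite /= oner_eq0.
split; last by move=> b [/BQ|->].
have neq b : B b -> (b == x) = false.
  move=> Bb; apply/eqP => bx; move: (xB b Bb); rewrite bx inner_nsq x1.
  by move=> /(congr1 (@complex.Re R)) /eqP; rewrite /= oner_eq0.
move=> e f [Be|->] [Bf|->].
- exact: oB.
- by rewrite innerJ xB // neq // rmorph0.
- by rewrite xB // eq_sym neq.
- by rewrite eqxx inner_nsq x1.
Qed.

Lemma orthonormal_basis_exists : exists B : set H, orthonormal_basis B.
Proof.
have [B [oB _ mB]] := maximal_orthonormal setT; exists B; split=> // x xB.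
apply: nsq_eq0; apply/eqP/negPn/negP => x0.
apply: (mB (unit_of x)) => //; first exact: nsq_unit_of.
by move=> b Bb; rewrite innerZl xB // mulr0.
Qed.

End Completeness.

(** * Parseval identity, bounded operators, adjoints and diagonal operators *)

Section Parseval.
Context {R : realType} {H : hilbertType R}.
Implicit Types (x y : H) (s t : seq H) (B : set H) (M e : R) (T S P : H -> H).

Lemma fam_fset B (X : set H) : fsets B X ->
  exists2 s, fam B s & forall f : H -> \bar R, (\sum_(i \in X) f i = \sum_(i <- s) f i)%E.
Proof.
move=> [fX XB]; exists (finmap.enum_fset (fset_set X)).
  split; first exact: finmap.fset_uniq.
  by move=> b; rewrite in_fset_set // inE => /XB.
by move=> f; rewrite fsbig_finite.
Qed.

Lemma esum_fam_ub B (f : H -> \bar R) s : fam B s ->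
  (\sum_(b <- s) f b <= \esum_(b in B) f b)%E.
Proof.
move=> [us sB]; apply: ereal_sup_ubound; exists [set` s] => /=.
  by split=> [|b /= /sB //]; exact: finite_seq.
by rewrite -fsbig_seq.
Qed.

Lemma esum_fam_le B (f : H -> \bar R) (M : \bar R) :
  (forall s, fam B s -> \sum_(b <- s) f b <= M)%E ->
  (\esum_(b in B) f b <= M)%E.
Proof.
move=> h; apply: ge_ereal_sup => _ [X /fam_fset[s fs sE] <-].
by rewrite sE h.
Qed.

Lemma esum_real_fam_le B (f : H -> R) M :
  (forall s, fam B s -> \sum_(b <- s) f b <= M) ->
  (\esum_(b in B) (f b)%:E <= M%:E)%E.
Proof. by move=> h; apply: esum_fam_le => s fs; rewrite sumEFin lee_fin h. Qed.

Lemma inner_basis_eq B x y : orthonormal_basis B ->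
  (forall b, B b -> inner x b = inner y b) -> x = y.
Proof.
move=> [_ cB] h; apply/eqP; rewrite -subr_eq0; apply/eqP/cB => b Bb.
by rewrite innerBl h // subrr.
Qed.

(** The vector that [riesz_fischer] builds from the coefficients of [x] has the same coefficients as
    [x], hence is [x]. *)
Lemma basis_approx B x e : orthonormal_basis B -> 0 < e ->
  exists2 s, fam B s & nsq (x - fsum s (inner x)) < e.
Proof.
move=> oB e0; have [y [yB ye]] := @riesz_fischer _ _ B (inner x) (nsq x) (proj1 oB)
  (fun s fs => bessel x (ons_fam (proj1 oB) fs)).
by move: (ye e e0); rewrite (inner_basis_eq oB yB).
Qed.

Lemma parseval B x : orthonormal_basis B ->
  (\esum_(b in B) (csq (inner x b))%:E = (nsq x)%:E)%E.
Proof.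
move=> oB; apply/eqP; rewrite eq_le; apply/andP; split.
  apply: esum_real_fam_le => s fs; apply: bessel; exact: ons_fam (proj1 oB) fs.
apply/lee_addgt0Pr => e e0; have [s fs] := basis_approx x oB e0.
rewrite (nsq_fsumB _ (ons_fam (proj1 oB) fs)) => h.
apply: (@le_trans _ _ ((\sum_(b <- s) csq (inner x b))%:E + e%:E)%E).
  by rewrite -EFinD lee_fin; lra.
by rewrite leeD2r // -sumEFin esum_fam_ub.
Qed.

Lemma nsq_le_fam B x M : orthonormal_basis B ->
  (forall s, fam B s -> \sum_(b <- s) csq (inner x b) <= M) -> nsq x <= M.
Proof. by move=> oB h; rewrite -lee_fin -(parseval x oB) esum_real_fam_le. Qed.

(** Boundedness for squared norms with a real constant, equivalent to [bounded_operator] by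
    [bounded_operatorP]. *)
Definition bop T : Prop := linear T /\ exists2 C, 0 <= C & forall x, nsq (T x) <= C * nsq x.

Section Linear.
Variables (T : H -> H) (lT : linear T).

Lemma linearfD x y : T (x + y) = T x + T y.
Proof. by rewrite -[x in LHS]scale1r lT scale1r. Qed.

Lemma linearf0 : T 0 = 0.
Proof. by apply: (addrI (T 0)); rewrite -linearfD !addr0. Qed.

Lemma linearfZ a x : T (a *: x) = a *: T x.
Proof. by rewrite -[_ *: x]addr0 lT linearf0 addr0. Qed.

Lemma linearfN x : T (- x) = - T x.
Proof. by rewrite -scaleN1r linearfZ scaleN1r. Qed.

Lemma linearfB x y : T (x - y) = T x - T y.
Proof. by rewrite linearfD linearfN. Qed.

Lemma linearf_sum I (r : seq I) (F : I -> H) :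
  T (\sum_(i <- r) F i) = \sum_(i <- r) T (F i).
Proof. by elim/big_rec2: _ => [|i y x _ <-]; rewrite ?linearf0 ?linearfD. Qed.

Lemma linearf_fsum s c : T (fsum s c) = \sum_(b <- s) c b *: T b.
Proof. by rewrite linearf_sum; apply: eq_bigr => b _; rewrite linearfZ. Qed.

End Linear.

Lemma bounded_operatorP T : bounded_operator T <-> bop T.
Proof.
split=> [[lT [M hM]]|[lT [C C0 hC]]]; split=> //.
  exists (Re M ^+ 2); first exact: sqr_ge0.
  move=> x; have := hM x; rewrite !norm_nr lecE /= ReM /= mulr0 subr0 => /andP[_ h].
  by rewrite !nsqE -exprMn ler_pXn2r // nnegrE ?nr_ge0 // (le_trans _ h) ?nr_ge0.
exists (Num.sqrt C)%:C%C => x; rewrite !norm_nr -rmorphM lecR.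
by rewrite !nr_sqrt -sqrtrM // ler_wsqrtr.
Qed.

Lemma bop_comp T S : bop T -> bop S -> bop (T \o S).
Proof.
move=> [lT [C C0 hC]] [lS [D D0 hD]]; split.
  by move=> a x y /=; rewrite lS lT.
exists (C * D) => [|x /=]; first exact: mulr_ge0.
by apply: le_trans (hC _) _; rewrite -mulrA ler_wpM2l.
Qed.

Lemma bopD T S : bop T -> bop S -> bop (fun x => T x + S x).
Proof.
move=> [lT [C C0 hC]] [lS [D D0 hD]]; split.
  by move=> a x y /=; rewrite lS lT scalerDr addrACA.
exists (2 * C + 2 * D) => [|x /=]; first by lra.
by have := nsqD_le (T x) (S x); have := hC x; have := hD x; lra.
Qed.

Lemma bopZ a T : bop T -> bop (fun x => a *: T x).
Proof.
move=> [lT [C C0 hC]]; split.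
  by move=> b x y /=; rewrite lT scalerDr !scalerA mulrC.
exists (csq a * C) => [|x /=]; first by rewrite mulr_ge0 ?csq_ge0.
by rewrite nsqZ -mulrA ler_wpM2l ?csq_ge0.
Qed.

(** Every [x] is close to a finite combination of basis vectors, where [g] vanishes. This allows
    identities between bounded operators to be checked on a basis. *)
Lemma functional_eq0 B (g : H -> R[i]) (K : R) : orthonormal_basis B -> 0 <= K ->
  (forall a x y, g (a *: x + y) = a * g x + g y) ->
  (forall x, csq (g x) <= K * nsq x) -> (forall b, B b -> g b = 0) ->
  forall x, g x = 0.
Proof.
move=> oB K0 lg hK gB x; apply: csq_eq0; apply/eqP; rewrite eq_le csq_ge0 andbT.
have g0 : g 0 = 0.
  by apply: (addrI (g 0)); rewrite addr0 -{3}[0]addr0 -{3}[0](scale1r 0) lg mul1r.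
apply/ler_addgt0Pr => e e0; rewrite add0r.
have ek : 0 < e / (K + 1) by rewrite divr_gt0 //; lra.
have [s [us sB] h] := basis_approx x oB ek.
have -> : g x = g (x - fsum s (inner x)).
  rewrite addrC -scaleN1r lg.
  suff -> : g (fsum s (inner x)) = 0 by rewrite mulr0 add0r.
  rewrite /fsum; elim: s sB {us h} => [|b s IH] sB; first by rewrite big_nil.
  rewrite big_cons lg gB ?mulr0 ?add0r; last by apply: sB; rewrite inE eqxx.
  by apply: IH => f fs; apply: sB; rewrite inE fs orbT.
apply: le_trans (hK _) _; move: h; rewrite ltr_pdivlMr; last by lra.
by have := nsq_ge0 (x - fsum s (inner x)); nra.
Qed.

Lemma bop_eq B T S : orthonormal_basis B -> bop T -> bop S ->
  (forall b, B b -> T b = S b) -> T = S.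
Proof.
move=> oB [lT [C C0 hC]] [lS [D D0 hD]] h; apply/funext => x.
apply: (inner_basis_eq oB) => b Bb; apply/eqP; rewrite -subr_eq0; apply/eqP.
apply: (@functional_eq0 B (fun x => inner (T x) b - inner (S x) b) (2 * C + 2 * D)) => //.
- by lra.
- by move=> a y z; rewrite lT lS !innerE; ring.
- move=> y; rewrite -innerBl; apply: le_trans (cauchy_schwarz _ _) _.
  have -> : nsq b = 1 by rewrite /nsq (proj1 oB) // eqxx.
  have := nsqD_le (T y) (- S y); rewrite nsqN.
  by have := hC y; have := hD y; lra.
- by move=> c Bc; rewrite h // subrr.
Qed.

(** Riesz representation of [x |-> <T x, y>], by the vector whose coefficients in a basis are the
    conjugates of [<T b, y>]. *)
Lemma bop_adjoint T : bop T -> exists S, forall x y, inner (T x) y = inner x (S y).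
Proof.
move=> [lT [C C0 hC]]; have [B oB] := @orthonormal_basis_exists R H.
suff h y : exists u, forall x, inner (T x) y = inner x u.
  by have [S hS] := choice h; exists S => x y; rewrite hS.
have [|u [uB _]] := @riesz_fischer _ _ B (fun b => (inner (T b) y)^* ) (C * nsq y) (proj1 oB).
  (* The functional takes the value [v] at [fsum s c], whose squared norm is also [v];
     Cauchy-Schwarz then gives [v^2 <= C v |y|^2]. *)
  move=> s fs; pose c b := (inner (T b) y)^*; set v := \sum_(b <- s) _.
  have vE : inner (T (fsum s c)) y = v%:C%C.
    rewrite linearf_fsum // inner_suml rmorph_sum /=; apply: eq_bigr => b _.
    by rewrite innerZl -csqE conjCK.
  have v0 : 0 <= v by apply: sumr_ge0 => b _; exact: csq_ge0.
  have := cauchy_schwarz (T (fsum s c)) y; rewrite vE csqR => h1.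
  have := hC (fsum s c); rewrite (nsq_fsum _ (ons_fam (proj1 oB) fs)) -/v => h2.
  have [->|vn] := eqVneq v 0; first by rewrite mulr_ge0 ?nsq_ge0.
  have vp : 0 < v by rewrite lt0r vn.
  rewrite -(ler_pM2l vp) -expr2; apply: le_trans h1 _.
  by rewrite mulrA [v * C]mulrC ler_wpM2r ?nsq_ge0.
exists u => x; apply/eqP; rewrite -subr_eq0; apply/eqP; move: x.
apply: (@functional_eq0 B _ (2 * (C * nsq y) + 2 * nsq u)) => //.
- by rewrite addr_ge0 // mulr_ge0 ?nsq_ge0 // mulr_ge0 ?nsq_ge0.
- by move=> a x z; rewrite lT !innerE; ring.
- move=> x; apply: le_trans (csqD_le _ _) _; rewrite csqN.
  have := cauchy_schwarz x u; have := cauchy_schwarz (T x) y.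
  by have := ler_wpM2r (nsq_ge0 y) (hC x); lra.
- by move=> b Bb; rewrite [inner b u]innerJ uB // conjCK subrr.
Qed.

Lemma adjointP T : bop T -> forall x y, inner (T x) y = inner x (adjoint T y).
Proof. by move=> /bop_adjoint[S hS]; rewrite /adjoint; case: xgetP => [? _ //|/(_ S)]. Qed.

Lemma adjointPl T : bop T -> forall x y, inner (adjoint T x) y = inner x (T y).
Proof. by move=> bT x y; rewrite innerJ -adjointP // -innerJ. Qed.

Lemma inner_ext x y : (forall z, inner x z = inner y z) -> x = y.
Proof.
move=> h; apply/eqP; rewrite -subr_eq0; apply/eqP/nsq_eq0.
by rewrite /nsq innerBl h subrr.
Qed.

Lemma adjoint_unique T S : (forall x y, inner (T x) y = inner x (S y)) -> adjoint T = S.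
Proof.
move=> hS; rewrite /adjoint; case: xgetP => [A _ hA|/(_ S)//].
apply/funext => y; apply: inner_ext => z.
by rewrite innerJ -hA hS -innerJ.
Qed.

(** For [y = T^* x] one has [|y|^4 = |<T y, x>|^2 <= C |y|^2 |x|^2], so the constant [C] is kept. *)
Lemma bop_adjoint_bop T : bop T -> bop (adjoint T).
Proof.
move=> bT; have [lT [C C0 hC]] := bT; split.
  move=> a x y; apply: inner_ext => z.
  by rewrite adjointPl // !innerE !adjointPl.
exists C => // x; set y := adjoint T x.
have h1 : inner (T y) x = (nsq y)%:C%C by rewrite adjointP // inner_nsq.
have := cauchy_schwarz (T y) x; rewrite h1 csqR => h2.
have [->|yn] := eqVneq (nsq y) 0; first by rewrite mulr_ge0 ?nsq_ge0.
have yp : 0 < nsq y by rewrite lt0r yn nsq_ge0.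
rewrite -(ler_pM2l yp) -expr2; apply: le_trans h2 _.
by rewrite mulrA [nsq y * C]mulrC ler_wpM2r ?nsq_ge0.
Qed.

(** Built coordinate by coordinate with [riesz_fischer]. The modulus, powers and square roots below
    rest on it. *)
Lemma diag_operator B (d : H -> R) D : orthonormal_basis B ->
  (forall b, B b -> 0 <= d b <= D) ->
  exists2 P, bop P & forall x b, B b -> inner (P x) b = (d b)%:C%C * inner x b.
Proof.
move=> oB dD.
have bd x s : fam B s -> \sum_(b <- s) csq ((d b)%:C%C * inner x b) <= D ^+ 2 * nsq x.
  move=> fs; apply: le_trans (ler_wpM2l (sqr_ge0 D) (bessel x (ons_fam (proj1 oB) fs))).
  rewrite mulr_sumr big_seq [leRHS]big_seq; apply: ler_sum => b bs.
  have /dD/andP[d0 dM] : B b by case: fs => _; apply.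
  rewrite csqM csqR ler_wpM2r ?csq_ge0 // ler_pXn2r // nnegrE //.
  exact: le_trans dM.
have h x : exists y, forall b, B b -> inner y b = (d b)%:C%C * inner x b.
  by have [y [yB _]] := riesz_fischer (proj1 oB) (bd x); exists y.
have [P hP] := choice h; exists P => //; split.
  move=> a x y; apply: (inner_basis_eq oB) => b Bb.
  by rewrite innerDl innerZl !hP // !innerE; ring.
exists (D ^+ 2) => [|x]; first exact: sqr_ge0.
apply: (nsq_le_fam oB) => s fs; apply: le_trans (bd x s fs).
rewrite big_seq [leRHS]big_seq ler_sum // => b bs.
by rewrite hP //; case: fs => _; apply.
Qed.

Lemma diag_basis B (d : H -> R) P : orthonormal_basis B ->
  (forall x b, B b -> inner (P x) b = (d b)%:C%C * inner x b) ->
  forall b, B b -> P b = (d b)%:C%C *: b.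
Proof.
move=> oB hP b Bb; apply: (inner_basis_eq oB) => c Bc.
rewrite hP // innerZl (proj1 oB) //; case: eqP => [->//|_].
by rewrite !mulr0.
Qed.

End Parseval.

(** * Compact operators *)

Section Compactness.
Context {R : realType} {H : hilbertType R}.
Implicit Types (x y z : H) (B : set H) (e : R) (T S G : H -> H).

Lemma ultra_fmap (f : H -> H) (F : set_system H) :
  UltraFilter F -> UltraFilter (f @ F).
Proof.
move=> UF; split; first exact: fmap_proper_filter.
move=> G PG FG; apply/seteqP; split=> // A GA.
have [//|FnA] := in_ultra_setVsetC (f @^-1` A) UF.
have GnA : G (~` A) by apply: FG.
have GI : G (A `&` ~` A) by exact: filterI.
by have [x []] := filter_ex GI.
Qed.

(* Sequential compactness of [T], with ultrafilters instead of subsequences. *)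
Definition ucompact T : Prop := forall F : set_system H, UltraFilter F ->
  F [set x | nsq x <= 1] ->
  exists y, forall e, 0 < e -> F [set x | nsq (T x - y) < e].

(** The image ultrafilter has a cluster point, and an ultrafilter converges to each of its cluster
    points. *)
Lemma compact_ucompact T : compact_operator T -> ucompact T.
Proof.
move=> [_]; rewrite precompactE => cT F UF F1.
have FT : (T @ F) (closure (T @` [set x | `|x| <= 1])).
  rewrite /fmap /=; apply: filterS F1 => x /= x1.
  apply: subset_closure; exists x => //=.
  rewrite norm_nr -[1]/(1%:C%C) lecR -(@ler_pXn2r _ 2) ?nnegrE ?nr_ge0 //.
  by rewrite -nsqE expr1n.
have [y [_ yc]] := cT _ _ FT; exists y => e e0.
have [//|Fn] := in_ultra_setVsetC [set x | nsq (T x - y) < e] UF.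
have se : 0 < Num.sqrt e by rewrite sqrtr_gt0.
have [] := yc [set z | ~ nsq (z - y) < e] (ball y (Num.sqrt e)%:C%C) Fn.
  by apply: nbhsx_ballx; rewrite ltcR.
move=> z [/= h1]; rewrite -ball_normE /= distrC nsq_ltP //.
by rewrite sqr_sqrtr // ltW.
Qed.

Lemma ucompactD T S : ucompact T -> ucompact S -> ucompact (fun x => T x + S x).
Proof.
move=> cT cS F UF F1; have [y hy] := cT F UF F1; have [z hz] := cS F UF F1.
exists (y + z) => e e0; have e4 : 0 < e / 4 by lra.
apply: filterS2 (hy _ e4) (hz _ e4) => x /= h1 h2.
rewrite opprD addrACA.
by have := nsqD_le (T x - y) (S x - z); lra.
Qed.

Lemma ucompact_compl T S : bop T -> ucompact S -> ucompact (T \o S).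
Proof.
move=> [lT [C C0 hC]] cS F UF F1; have [y hy] := cS F UF F1.
exists (T y) => e e0; have eC : 0 < e / (C + 1) by rewrite divr_gt0 //; lra.
apply: filterS (hy _ eC) => x /=; rewrite ltr_pdivlMr; last by lra.
have := hC (S x - y); rewrite (linearfB lT).
by have := nsq_ge0 (S x - y); nra.
Qed.

Lemma ucompactZ a T : ucompact T -> ucompact (fun x => a *: T x).
Proof.
move=> cT; apply: (@ucompact_compl (fun x => a *: x)) => //; split.
  by move=> b x y; rewrite scalerDr !scalerA mulrC.
by exists (csq a) => [|x]; rewrite ?csq_ge0 // nsqZ.
Qed.

Lemma ucompact_compr T S : linear T -> ucompact T -> bop S -> ucompact (T \o S).
Proof.
move=> lT cT [lS [C C0 hC]] F UF F1.
(* Dividing [S] by [k] maps the unit ball into itself; [C + 1] replaces [C] to keep the divisor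
   nonzero. *)
set k := Num.sqrt (C + 1).
have k2 : k ^+ 2 = C + 1 by rewrite sqr_sqrtr //; lra.
have k0 : k != 0 by apply: contraTneq C0 => k0; move: k2; rewrite k0 expr0n /=; lra.
pose f x := (k^-1)%:C%C *: S x.
have fF : F [set x | nsq (f x) <= 1].
  apply: filterS F1 => x /= x1; rewrite nsqZ csqR exprVn k2 mulrC ler_pdivrMr; last by lra.
  by rewrite mul1r; have := hC x; nra.
have [y hy] := cT (f @ F) (ultra_fmap f UF) fF.
exists (k%:C%C *: y) => e e0.
have ek : 0 < e / (C + 1) by rewrite divr_gt0 //; lra.
have hF : F [set x | nsq (T (f x) - y) < e / (C + 1)] := hy _ ek.
apply: filterS hF => x /=; rewrite ltr_pdivlMr; last by lra.
move=> h; have -> : T (S x) = k%:C%C *: T (f x).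
  by rewrite -linearfZ // /f scalerA -rmorphM mulfV // scale1r.
by rewrite -scalerBr nsqZ csqR k2 mulrC.
Qed.

Lemma nsq_adjoint_le T x : bop T ->
  nsq (adjoint T x) ^+ 2 <= nsq (T (adjoint T x)) * nsq x.
Proof.
move=> bT; have := cauchy_schwarz (T (adjoint T x)) x.
by rewrite adjointP // inner_nsq csqR.
Qed.

(** Schauder's theorem: [T T^*] is compact, and [nsq_adjoint_le] applied to differences turns
    convergence of [T T^* x] into the Cauchy property for [T^* x]. *)
Lemma ucompact_adjoint T : bop T -> ucompact T -> ucompact (adjoint T).
Proof.
move=> bT cT F UF F1; have [lT _] := bT.
have bA := bop_adjoint_bop bT; have [lA _] := bA.
have [y hy] := ucompact_compr lT cT bA UF F1.
have PF : ProperFilter (adjoint T @ F) by apply: fmap_proper_filter.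
have [e e0|z /cvg_nsqP hz] := complete_nsq PF; last by exists z.
(* Two points within [e^2 / 16] of [y] are within [e^2 / 4] of each other, and [|x' - x|^2 <= 4] on
   the unit ball; the product is below [e^2]. *)
have e16 : 0 < e ^+ 2 / 16 by rewrite divr_gt0 ?exprn_gt0.
have hF : F ([set x | nsq (T (adjoint T x) - y) < e ^+ 2 / 16] `&` [set x | nsq x <= 1]).
  by apply: filterI => //; exact: hy.
have [x [/= hx x1]] := filter_ex hF.
exists (adjoint T x); rewrite /fmap /=; apply: filterS hF => x' [/= hx' x1'].
rewrite -linearfB //.
have := nsq_adjoint_le (x' - x) bT; rewrite !linearfB //.
set u := T (adjoint T x') in hx' *; set v := T (adjoint T x) in hx *.
have h1 : nsq (u - v) < e ^+ 2 / 4.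
  have := nsqD_le (u - y) (y - v); rewrite subrKA -[X in _ + 2 * X]nsqN opprB.
  by lra.
have h2 : nsq (x' - x) <= 4.
  by have := nsqD_le x' (- x); rewrite nsqN; lra.
have h3 : nsq (u - v) * nsq (x' - x) < e ^+ 2.
  by have := nsq_ge0 (u - v); have := nsq_ge0 (x' - x); nra.
move=> h4; have h5 := le_lt_trans h4 h3.
by rewrite -(@ltr_pXn2r _ 2) ?nnegrE ?nsq_ge0 // ltW.
Qed.

Definition symmetric_operator T : Prop := forall x y, inner (T x) y = inner x (T y).

(* A maximising sequence [x] of |G x| on the unit sphere of the orthogonal of
   [B] is almost an eigenvector of [G^2], and [G x] subconverges. *)
Lemma eigenvector_square B G (m : R) : bop G -> ucompact G -> symmetric_operator G ->
  (forall b, B b -> nsq b = 1) -> 0 < m ->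
  (forall x, (forall b, B b -> inner x b = 0) -> forall b, B b -> inner (G x) b = 0) ->
  (forall x, (forall b, B b -> inner x b = 0) -> nsq (G x) <= m * nsq x) ->
  (forall e, 0 < e -> exists x,
     [/\ (forall b, B b -> inner x b = 0), nsq x = 1 & m - e < nsq (G x)]) ->
  exists z, [/\ forall b, B b -> inner z b = 0, z != 0 & G (G z) = m%:C%C *: z].
Proof.
move=> bG cG sG B1 m0 BG hm hsup; have [lG [C C0 hC]] := bG.
pose D e := [set x | [/\ (forall b, B b -> inner x b = 0), nsq x = 1 & m - e < nsq (G x)]].
have FD : ProperFilter (filter_from [set e : R | 0 < e] D).
  apply: filter_from_proper; last by move=> e /= /hsup.
  apply: filter_from_filter; first by exists 1 => /=.
  move=> e f /= e0 f0; exists (Num.min e f); first by rewrite /= lt_min e0.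
  move=> x [xB x1 h]; split; split=> //; apply: le_lt_trans h;
    by rewrite lerB // ge_min lexx ?orbT.
have [F [UF FF]] := ultraFilterLemma FD.
have [|y hy] := cG F UF.
  by apply: FF; exists 1 => //= x [_ x1 _] /=; rewrite x1.
have near e : 0 < e -> exists x, [/\ D e x & nsq (G x - y) < e].
  move=> e0; have FDe : F (D e) by apply: FF; exists e.
  have FI : F (D e `&` [set x | nsq (G x - y) < e]) by apply: filterI => //; exact: hy.
  by have [x [h1 h2]] := filter_ex FI; exists x; split.
(* The limit of the maximising vectors: [m x] is close to [G (G x)], and [G x] to [y]. *)
pose z : H := (m^-1)%:C%C *: G y.
(* In the expansion of the square, [|G (G x)|^2 <= m |G x|^2] because [G x] is again orthogonal to
   [B]. *)
have sq x : (forall b, B b -> inner x b = 0) -> nsq x = 1 ->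
    nsq (G (G x) - m%:C%C *: x) <= m * (m - nsq (G x)).
  move=> xB x1; rewrite nsqB nsqZ innerZr csqR conjCR sG inner_nsq -rmorphM /= x1.
  by have := hm _ (BG _ xB); lra.
have app e : 0 < e -> exists x, [/\ forall b, B b -> inner x b = 0, nsq x = 1,
    nsq (x - z) < e & nsq (G (G x) - m%:C%C *: x) < e].
  move=> e0; have d0 : 0 < e * m ^+ 2 / (2 * m + 2 * C + 1).
    by rewrite divr_gt0 ?mulr_gt0 ?exprn_gt0 //; lra.
  have d1 : 0 < e / (2 * m) by rewrite divr_gt0 // mulr_gt0.
  have dm : 0 < Num.min (e * m ^+ 2 / (2 * m + 2 * C + 1)) (e / (2 * m)).
    by rewrite lt_min d0.
  have [x [[xB x1 xm] xy]] := near _ dm; exists x; move: dm xm xy.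
  set d := Num.min _ _ => dm xm xy.
  have k1 : d * (2 * m + 2 * C + 1) <= e * m ^+ 2.
    by rewrite -ler_pdivlMr ?ge_min ?lexx //; lra.
  have k2 : d * (2 * m) <= e by rewrite -ler_pdivlMr ?ge_min ?lexx ?orbT // mulr_gt0.
  have k3 : nsq (G (G x) - m%:C%C *: x) <= m * d.
    by apply: le_trans (sq x xB x1) _; rewrite ler_wpM2l ?ltW //; lra.
  split=> //; last by nra.
  have -> : x - z = (m^-1)%:C%C *: (m%:C%C *: x - G y).
    by rewrite scalerBr scalerA -rmorphM mulVf ?gt_eqF // scale1r.
  rewrite nsqZ csqR exprVn mulrC ltr_pdivrMr ?exprn_gt0 //.
  have := nsqD_le (m%:C%C *: x - G (G x)) (G (G x) - G y).
  rewrite subrKA -[X in _ <= 2 * X + _]nsqN opprB -(linearfB lG).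
  by have := hC (G x - y); nra.
have zB b : B b -> inner z b = 0.
  move=> Bb; apply/csq_eq0/eqP; rewrite eq_le csq_ge0 andbT.
  apply/ler_addgt0Pr => e e0; rewrite add0r.
  have [x [xB x1 xz _]] := app _ e0.
  have -> : inner z b = - inner (x - z) b by rewrite innerBl xB // sub0r opprK.
  rewrite csqN; apply: le_trans (cauchy_schwarz _ _) _.
  by rewrite (B1 b Bb) mulr1 ltW.
exists z; split=> //.
  apply/eqP => z0; have [|x [_ x1 + _]] := app 1; first by [].
  by rewrite z0 subr0 x1 ltxx.
apply/eqP; rewrite -subr_eq0; apply/eqP/nsq_eq0/eqP.
rewrite eq_le nsq_ge0 andbT; apply/ler_addgt0Pr => e e0; rewrite add0r.
have K : 0 < 8 * C ^+ 2 + 8 * m ^+ 2 + 4.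
  by have := sqr_ge0 C; have := sqr_ge0 m; lra.
have [x [xB x1 xz xG]] := app _ (divr_gt0 e0 K).
move: xz xG; rewrite !ltr_pdivlMr // => xz xG.
set u := G (G x) - _ in xG.
have -> : G (G z) - m%:C%C *: z = u + - (G (G (x - z)) - m%:C%C *: (x - z)).
  by rewrite /u !(linearfB lG) scalerBr opprB addrA subrKA opprB [RHS]addrC subrKA.
apply: le_trans (nsqD_le _ _) _; rewrite nsqN.
have := nsqD_le (G (G (x - z))) (- (m%:C%C *: (x - z))); rewrite nsqN nsqZ csqR.
have hCC : nsq (G (G (x - z))) <= C ^+ 2 * nsq (x - z).
  by apply: le_trans (hC _) _; rewrite expr2 -mulrA ler_wpM2l.
have := mulr_ge0 (nsq_ge0 u) (sqr_ge0 C); have := mulr_ge0 (nsq_ge0 u) (sqr_ge0 m).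
by have := nsq_ge0 u; have := nsq_ge0 (x - z); lra.
Qed.

(** If [G^2 z = k^2 z], then [G z + k z] is either zero, so that [z] has eigenvalue [- k], or an
    eigenvector for [k]. When the supremum [m] is 0, [G] vanishes on the orthogonal of [B]. *)
Lemma compact_eigenvector B G : bop G -> ucompact G -> symmetric_operator G ->
  (forall b, B b -> nsq b = 1) ->
  (forall x, (forall b, B b -> inner x b = 0) -> forall b, B b -> inner (G x) b = 0) ->
  (exists2 x, (forall b, B b -> inner x b = 0) & x != 0) ->
  exists x (l : R), [/\ forall b, B b -> inner x b = 0, x != 0 & G x = l%:C%C *: x].
Proof.
move=> bG cG sG B1 BG [x0 x0B x00]; have [lG [C C0 hC]] := bG.
pose V := [set x | (forall b, B b -> inner x b = 0) /\ nsq x = 1].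
have unitV x : (forall b, B b -> inner x b = 0) -> x != 0 -> V (unit_of x).
  move=> xB xn; split.
    by move=> b Bb; rewrite innerZl xB // mulr0.
  by apply: nsq_unit_of; apply: contraNneq xn => /nsq_eq0 ->.
pose S := [set nsq (G x) | x in V].
have S0 : has_sup S.
  split; first by exists (nsq (G (unit_of x0))); exists (unit_of x0) => //; apply: unitV.
  exists C => _ [x [_ x1] <-].
  by have := hC x; rewrite x1 mulr1.
pose m := sup S.
have hm x : (forall b, B b -> inner x b = 0) -> nsq (G x) <= m * nsq x.
  move=> xB; have [->|xn] := eqVneq x 0.
    by rewrite (linearf0 lG) nsq0 mulr0.
  have : nsq (G (unit_of x)) <= m.
    by apply: ub_le_sup; [case: S0|exists (unit_of x) => //; apply: unitV].
  rewrite (linearfZ lG) nsqZ csqR exprVn -nsqE mulrC ler_pdivrMr //.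
  by rewrite lt0r nsq_ge0 andbT; apply: contraNneq xn => /nsq_eq0 ->.
have m0 : 0 <= m.
  apply: le_trans (nsq_ge0 (G (unit_of x0))) _.
  by apply: ub_le_sup; [case: S0|exists (unit_of x0) => //; apply: unitV].
have [mz|mn] := eqVneq m 0.
  exists x0, 0; split=> //; rewrite scale0r; apply: nsq_eq0; apply/eqP.
  by rewrite eq_le nsq_ge0 andbT; have := hm x0 x0B; rewrite mz mul0r.
have mp : 0 < m by rewrite lt0r mn.
have [e e0|z [zB z0 zG]] := eigenvector_square bG cG sG B1 mp BG hm.
  by have [_ [x [xB x1] <-] h] := sup_adherent e0 S0; exists x.
pose k := Num.sqrt m.
have kE : m%:C%C = k%:C%C * k%:C%C :> R[i] by rewrite -rmorphM -expr2 sqr_sqrtr.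
have [h|h] := eqVneq (G z + k%:C%C *: z) 0.
  exists z, (- k); split=> //.
  by rewrite rmorphN scaleNr; apply/eqP; rewrite -addr_eq0 h.
exists (G z + k%:C%C *: z), k; split=> //.
  by move=> b Bb; rewrite innerDl innerZl (BG _ zB) // zB // mulr0 addr0.
by rewrite (linearfD lG) (linearfZ lG) zG scalerDr scalerA kE addrC.
Qed.

(** By symmetry, the orthogonal of a maximal orthonormal set of eigenvectors is invariant; a nonzero
    vector there would give one more eigenvector. *)
Theorem spectral G : bop G -> ucompact G -> symmetric_operator G ->
  exists B (d : H -> R), orthonormal_basis B /\ forall b, B b -> G b = (d b)%:C%C *: b.
Proof.
move=> bG cG sG; have [lG _] := bG.
have [B [oB BQ mB]] := maximal_orthonormal [set x | exists l : R, G x = l%:C%C *: x].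
have [d hd] : exists d : H -> R, forall b, B b -> G b = (d b)%:C%C *: b.
  have h b : exists l : R, B b -> G b = l%:C%C *: b.
    have [/BQ[l hl]|nB] := pselect (B b); first by exists l.
    by exists 0.
  by have [d hd] := choice h; exists d.
exists B, d; split=> //; split=> // x xB.
have [//|x0] := eqVneq x 0; exfalso.
have [b Bb|y yB b Bb||y [l [yB y0 yl]]] := compact_eigenvector bG cG sG (B := B).
- by rewrite /nsq oB // eqxx.
- by rewrite sG hd // innerZr yB // mulr0.
- by exists x.
have y1 : nsq (unit_of y) = 1.
  by apply: nsq_unit_of; apply: contraNneq y0 => /nsq_eq0 ->.
apply: (mB (unit_of y)) => //.
  by exists l; rewrite (linearfZ lG) yl !scalerA mulrC.
by move=> b Bb; rewrite innerZl yB // mulr0.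
Qed.

End Compactness.

(** * Schatten norms *)

Section Schatten.
Context {R : realType} {H : hilbertType R}.
Implicit Types (x y z : H) (B E : set H) (T S K P : H -> H) (p : R).

Lemma esum_swap_le B E (a : H -> H -> \bar R) : (forall x y, 0 <= a x y)%E ->
  (\esum_(x in B) \esum_(y in E) a x y <= \esum_(y in E) \esum_(x in B) a x y)%E.
Proof.
move=> a0; apply: esum_fam_le => s fs; rewrite -esum_sum //.
by apply: le_esum => y _; apply: esum_fam_ub.
Qed.

Lemma esum_swap B E (a : H -> H -> \bar R) : (forall x y, 0 <= a x y)%E ->
  (\esum_(x in B) \esum_(y in E) a x y = \esum_(y in E) \esum_(x in B) a x y)%E.
Proof. by move=> a0; apply/eqP; rewrite eq_le !esum_swap_le. Qed.

(** Polarisation: the quadratic form is real at [x + y] and at [x + i y]. *)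
Lemma positive_symmetric T : linear T -> positive_operator T -> symmetric_operator T.
Proof.
move=> lT pT x y.
have im0 v : Im (inner (T v) v) = 0 by have := pT v; rewrite lecE => /andP[/eqP].
have h1 := im0 (x + y); have h2 := im0 (x + 'i%C *: y).
have := im0 x; have := im0 y; move: h1 h2.
rewrite !(linearfD lT) !(linearfZ lT) !innerE !reimE /= => h1 h2 hy hx.
rewrite (innerJ (T y) x); apply: eqC; rewrite !reimE; lra.
Qed.

Lemma symmetric_adjoint T : symmetric_operator T -> adjoint T = T.
Proof. exact: adjoint_unique. Qed.

Lemma diag_symmetric B (d : H -> R) P : orthonormal_basis B -> bop P ->
  (forall b, B b -> P b = (d b)%:C%C *: b) -> symmetric_operator P.
Proof.
move=> oB bP hP; suff aP : adjoint P = P by move=> x y; rewrite adjointP // aP.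
apply: (bop_eq oB) => //; first exact: bop_adjoint_bop.
move=> b Bb; apply: (inner_basis_eq oB) => c Bc.
rewrite adjointPl // !hP // innerZl innerZr (proj1 oB) // conjCR.
by case: eqP => [->|] //; rewrite !mulr0.
Qed.

Lemma square_positive S : symmetric_operator S -> positive_operator (S \o S).
Proof. by move=> sS x; rewrite /= sS inner_nsq lecR nsq_ge0. Qed.

(* The trace of [P = S^2] can be computed as the Hilbert-Schmidt norm of [S]
   in any basis. *)
Lemma trace_square B S : orthonormal_basis B -> symmetric_operator S ->
  trace (S \o S) = (\esum_(b in B) (nsq (S b))%:E)%E.
Proof.
move=> oB sS; rewrite /trace; set E := xget _ _.
have oE : orthonormal_basis E.
  by rewrite /E; case: xgetP => [? -> //|h]; have [F /h] := @orthonormal_basis_exists R H.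
transitivity (\esum_(e in E) \esum_(b in B) (csq (inner (S e) b))%:E)%E.
  by apply: eq_esum => e _; rewrite parseval //= sS.
rewrite esum_swap; last by move=> x y; rewrite lee_fin csq_ge0.
apply: eq_esum => b _; rewrite -(parseval (S b) oE); apply: eq_esum => e _.
by rewrite sS csq_innerC.
Qed.

(** Right singular vectors of [K]. The eigenvalue of [K^* K] at a unit eigenvector [b] is
    necessarily [|K b|^2]. *)
Definition singular_basis K B := orthonormal_basis B /\
  forall b, B b -> adjoint K (K b) = (nsq (K b))%:C%C *: b.

Lemma singular_basis_exists K : bop K -> ucompact K -> exists B, singular_basis K B.
Proof.
move=> bK cK; have bA := bop_adjoint_bop bK.
have [|||B [d [oB hd]]] := @spectral R H (adjoint K \o K).
- exact: bop_comp.
- exact: ucompact_compl.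
- by move=> x y; rewrite /= adjointPl // adjointP.
exists B; split=> // b Bb; have /= hb := hd b Bb; rewrite hb; congr (_%:C%C *: _).
have : inner (adjoint K (K b)) b = (d b)%:C%C by rewrite hb innerZl (proj1 oB) // eqxx mulr1.
by rewrite adjointPl // inner_nsq => -[].
Qed.

Lemma bop_nr_le K : bop K -> exists2 C, 0 <= C & forall x, nsq x = 1 -> nr (K x) <= C.
Proof.
move=> [_ [C C0 hC]]; exists (Num.sqrt C) => // x x1.
by rewrite nr_sqrt ler_wsqrtr //; have := hC x; rewrite x1 mulr1.
Qed.

(** An operator with these properties has to be exhibited. It is taken as [S \o S], with [S]
    diagonal of entries [|K b|^(1/2)], which makes positivity immediate. *)
Lemma modulus_spec K : bop K -> ucompact K ->
  [/\ bop (modulus K), positive_operator (modulus K) &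
      forall x, modulus K (modulus K x) = adjoint K (K x)].
Proof.
move=> bK cK; have [B [oB hB]] := singular_basis_exists bK cK.
have [C C0 hC] := bop_nr_le bK.
have b1 b : B b -> nsq b = 1 by move=> Bb; rewrite /nsq (proj1 oB) // eqxx.
have [|S bS hS] := @diag_operator R H B (fun b => Num.sqrt (nr (K b))) (Num.sqrt C) oB.
  by move=> b Bb; rewrite sqrtr_ge0 ler_wsqrtr // hC // b1.
have SB := diag_basis oB hS; have [lS _] := bS.
have sS := diag_symmetric oB bS SB.
have SSB b : B b -> S (S b) = (nr (K b))%:C%C *: b.
  move=> Bb; rewrite (SB b Bb) (linearfZ lS) (SB b Bb) scalerA -rmorphM -expr2.
  by rewrite sqr_sqrtr ?nr_ge0.
have : [set S : H -> H | [/\ bounded_operator S,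
    positive_operator S & forall x, S (S x) = adjoint K (K x)]] (S \o S).
  have bSS := bop_comp bS bS; have [lSS _] := bSS.
  split; first exact/bounded_operatorP.
    exact: square_positive.
  move=> x; suff : (S \o S) \o (S \o S) = adjoint K \o K by move/(congr1 (fun f => f x)).
  apply: (bop_eq oB); [exact: bop_comp|exact: bop_comp (bop_adjoint_bop bK) bK|].
  move=> b Bb; rewrite /= hB // (SSB b Bb) !(linearfZ lS) (SSB b Bb) scalerA -rmorphM.
  by rewrite -expr2 -nsqE.
rewrite /modulus => hSS; case: xgetP => [T _ [bT pT hT]|/(_ _ hSS)//].
by split=> //; exact/bounded_operatorP.
Qed.

(** For [t = |K b|], the vector [z = |K| b - t b] satisfies [|K| z = - t z], which positivity
    forbids for [t > 0] unless [z = 0]. *)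
Lemma modulus_singular K B b : bop K -> ucompact K -> singular_basis K B -> B b ->
  modulus K b = (nr (K b))%:C%C *: b.
Proof.
move=> bK cK [oB hB] Bb; have [[lS _] pS SS] := modulus_spec bK cK.
have sS := positive_symmetric lS pS; set S := modulus K in lS pS SS sS *.
set t := nr (K b); pose z := S b - t%:C%C *: b.
have SSb : S (S b) = (t ^+ 2)%:C%C *: b by rewrite SS hB // nsqE.
suff : z = 0 by move/eqP; rewrite subr_eq0 => /eqP.
have [t0|t0] := eqVneq t 0.
  rewrite /z t0 scale0r subr0; apply: nsq_eq0.
  by rewrite /nsq -sS SSb t0 expr0n scale0r inner0l.
have Sz : S z = - (t%:C%C *: z).
  by rewrite /z (linearfB lS) (linearfZ lS) SSb scalerBr opprB scalerA -rmorphM -expr2.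
apply: nsq_eq0; apply/eqP; rewrite eq_le nsq_ge0 andbT.
have tp : 0 < t by rewrite lt0r t0 nr_ge0.
have := pS z; rewrite Sz innerNl innerZl inner_nsq -rmorphM -rmorphN lecR.
by rewrite oppr_ge0 pmulr_rle0.
Qed.

(** The power of the modulus is [S \o S] with [S] diagonal of entries [|K b|^(p/2)], so
    [trace_square] moves the trace to the basis [B]. *)
Lemma schatten_normE K B p : 0 < p -> bop K -> ucompact K -> singular_basis K B ->
  schatten_norm p K = ((\esum_(b in B) (nr (K b) `^ p)%:E) `^ p^-1)%E.
Proof.
move=> p0 bK cK sB; have [oB hB] := sB; rewrite /schatten_norm; congr (_ `^ _)%E.
have [C C0 hC] := bop_nr_le bK.
have b1 b : B b -> nsq b = 1 by move=> Bb; rewrite /nsq (proj1 oB) // eqxx.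
have [|S bS hS] := @diag_operator R H B (fun b => nr (K b) `^ (p / 2)) (C `^ (p / 2)) oB.
  move=> b Bb; rewrite powR_ge0 ge0_ler_powR ?nnegrE ?nr_ge0 //; first lra.
  by rewrite hC // b1.
have SB := diag_basis oB hS; have [lS _] := bS.
have sS := diag_symmetric oB bS SB.
have half b : nr (K b) `^ (p / 2) * nr (K b) `^ (p / 2) = nr (K b) `^ p.
  by rewrite -powRD -(splitr p) // gt_eqF.
have SSB b : B b -> S (S b) = (nr (K b) `^ p)%:C%C *: b.
  by move=> Bb; rewrite (SB b Bb) (linearfZ lS) (SB b Bb) scalerA -rmorphM half.
have [[lM bM] _ _] := modulus_spec bK cK.
have MB b : B b -> modulus K b = (nr (K b))%:C%C *: b by move=> Bb; exact: (modulus_singular bK cK sB).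
have sM := diag_symmetric oB (conj lM bM) MB.
have bSS := bop_comp bS bS.
have -> : operator_power (modulus K) p = S \o S.
  have hSS : [set P : H -> H | bounded_operator P /\ forall (l : R) x, 0 <= l ->
      modulus K x = l%:C%C *: x -> P x = (l `^ p)%:C%C *: x] (S \o S).
    split; first exact/bounded_operatorP.
    (* An eigenvector for [l] is orthogonal to each [b] with [|K b|] different from [l], so only
       coordinates with the right eigenvalue remain. *)
    move=> l x l0 Mx; apply: (inner_basis_eq oB) => b Bb.
    rewrite /= sS sS SSB // innerZr innerZl conjCR.
    have : inner (modulus K x) b = (nr (K b))%:C%C * inner x b.
      by rewrite sM MB // innerZr conjCR.
    rewrite Mx innerZl; have [->|x0] := eqVneq (inner x b) 0; first by rewrite !mulr0.
    by move/(mulIf x0) => -[->].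
  rewrite /operator_power; case: xgetP => [P _ [/bounded_operatorP bP hP]|/(_ _ hSS)//].
  apply: (bop_eq oB) => // b Bb; rewrite /= SSB //; apply: hP; first exact: nr_ge0.
  exact: MB.
rewrite (trace_square oB sS); apply: eq_esum => b Bb; congr (_%:E).
by rewrite SB // nsqZ b1 // mulr1 csqR expr2 half.
Qed.

End Schatten.

(** * Convexity inequalities for powers *)

Section PowerInequalities.
Context {R : realType}.
Implicit Types (x y t q : R).

(** Young's inequality for the exponents [q] and [q / (q - 1)], read as convexity: [t^q / q] lies
    above its tangent line at [y]. *)
Lemma young_tangent q y t : 1 <= q -> 0 <= y -> 0 <= t ->
  y `^ (q - 1) * t <= t `^ q / q + (1 - q^-1) * y `^ q.
Proof.
rewrite le_eqVlt => /predU1P[<-|q1] y0 t0.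
  by rewrite subrr powRr0 invr1 subrr mul1r mul0r addr0 mulr1 powRr1.
have q0 : 0 < q by lra.
have r0 : 0 < q / (q - 1) by rewrite divr_gt0 //; lra.
have q1' : q - 1 != 0 by rewrite gt_eqF //; lra.
have rE : (q / (q - 1))^-1 = 1 - q^-1 by rewrite invf_div mulrBl mul1r divff // gt_eqF.
have := @conjugate_powR R t (y `^ (q - 1)) q (q / (q - 1)) t0 (powR_ge0 _ _) q0 r0.
rewrite -powRrM mulrCA mulfV // mulr1 rE [t * _]mulrC [_ * (1 - _)]mulrC.
by apply; ring.
Qed.

(** The value at [t] of the tangent line of [s^q / q] at [s = y]. As a function of [y] it increases
    up to [y = t] and decreases afterwards. *)
Let g q t y := y `^ (q - 1) * t - (1 - q^-1) * y `^ q.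

Lemma powR_pred_homo q x y : 1 <= q -> 0 <= x -> x <= y -> x `^ (q - 1) <= y `^ (q - 1).
Proof.
move=> q1 x0 xy; rewrite ge0_ler_powR ?nnegrE ?subr_ge0 //.
exact: le_trans xy.
Qed.

Let g_homo q t x y : 1 <= q -> 0 <= x -> x <= y -> y <= t -> g q t x <= g q t y.
Proof.
move=> q1 x0 xy yt; have y0 := le_trans x0 xy.
have h1 := powR_pred_homo q1 x0 xy; have h2 := young_tangent q1 x0 y0.
have h3 := mulr_powRB1 y0 (lt_le_trans ltr01 q1); rewrite /g.
have h4 : 0 <= (y `^ (q - 1) - x `^ (q - 1)) * (t - y) by rewrite mulr_ge0 ?subr_ge0.
by lra.
Qed.

Let g_nhomo q t x y : 1 <= q -> 0 <= t -> t <= x -> x <= y -> g q t y <= g q t x.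
Proof.
move=> q1 t0 tx xy; have x0 := le_trans t0 tx; have y0 := le_trans x0 xy.
have h1 := powR_pred_homo q1 x0 xy; have h2 := young_tangent q1 y0 x0.
have h3 := mulr_powRB1 x0 (lt_le_trans ltr01 q1); rewrite /g.
have h4 : 0 <= (y `^ (q - 1) - x `^ (q - 1)) * (x - t) by rewrite mulr_ge0 ?subr_ge0.
by lra.
Qed.

Let g_ge0 q t y : 1 <= q -> 0 <= y -> y <= t -> 0 <= g q t y.
Proof.
move=> q1 y0 yt; have h3 := mulr_powRB1 y0 (lt_le_trans ltr01 q1); rewrite /g.
have h4 : 0 <= y `^ (q - 1) * (t - y) by rewrite mulr_ge0 ?powR_ge0 ?subr_ge0.
have h5 : 0 <= q^-1 * y `^ q by rewrite mulr_ge0 ?powR_ge0 // invr_ge0; lra.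
by lra.
Qed.

(** For [y j = s_j^2] and [q = p / 2] these are the weights [s_j^(p - 2)]. The value 0 at [n]
    removes the boundary term in summations by parts. *)
Definition weight q (y : nat -> R) n j := if (j < n)%N then y j `^ (q - 1) else 0.
(** Minus the constant term of the tangent line of [t^q / q] at [y j], with the same cut-off. *)
Definition dual_power q (y : nat -> R) n j := if (j < n)%N then (1 - q^-1) * y j `^ q else 0.

(* [t -> t ^ q / q] dominates the sum of the positive parts of these affine
   functions of [t], whose slopes add up to [y 0 ^ (q - 1)]: the increments of
   the unimodal function [y -> y ^ (q - 1) t - (1 - 1 / q) y ^ q] are compared
   with those of its truncation at its maximiser [y = t]. *)
Lemma sum_positive_parts q t n (y : nat -> R) : 1 <= q -> 0 <= t ->
  (forall j, 0 <= y j) -> (forall j, y j.+1 <= y j) ->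
  \sum_(k < n) Num.max 0 ((weight q y n k - weight q y n k.+1) * t -
                          (dual_power q y n k - dual_power q y n k.+1)) <= t `^ q / q.
Proof.
move=> q1 t0 y0 yd.
pose G j := if (j < n)%N then g q t (Num.min (y j) t) else 0.
have step k : (k < n)%N ->
    Num.max 0 ((weight q y n k - weight q y n k.+1) * t -
               (dual_power q y n k - dual_power q y n k.+1)) <= G k - G k.+1.
  move=> kn.
  have -> : (weight q y n k - weight q y n k.+1) * t -
      (dual_power q y n k - dual_power q y n k.+1) =
      g q t (y k) - (if (k.+1 < n)%N then g q t (y k.+1) else 0).
    by rewrite /g /weight /dual_power kn; case: ifP => _; ring.
  rewrite /G kn ge_max; case: ifP => _.
    have [ykt|tyk] := leP (y k) t.
      have y1t := le_trans (yd k) ykt; rewrite min_l // lexx subr_ge0 andbT.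
      exact: g_homo.
    have [y1t|ty1] := leP (y k.+1) t.
      by rewrite subr_ge0 g_homo //= lerB // g_nhomo // ltW.
    by rewrite subrr lexx subr_le0 g_nhomo // ltW.
  rewrite !subr0; have [ykt|tyk] := leP (y k) t; first by rewrite g_ge0 // lexx.
  by rewrite g_ge0 //= g_nhomo // ltW.
apply: (@le_trans _ _ (G 0%N)).
  apply: (@le_trans _ _ (\sum_(k < n) (G k - G k.+1))).
    by apply: ler_sum => k _; apply: step.
  have -> m : \sum_(k < m) (G k - G k.+1) = G 0%N - G m.
    by elim: m => [|m IH]; rewrite ?big_ord0 ?subrr // big_ord_recr /= IH subrKA.
  by rewrite {2}/G ltnn subr0.
rewrite /G; case: ifP => _; last by rewrite divr_ge0 ?powR_ge0 //; lra.
have h := young_tangent q1 (_ : 0 <= Num.min (y 0%N) t) t0.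
by rewrite lerBlDr h // le_min y0.
Qed.

Lemma abel_sum (a z : nat -> R) n :
  \sum_(k < n) (a k - a k.+1) * \sum_(j < k.+1) z j =
  \sum_(j < n) a j * z j - a n * \sum_(j < n) z j.
Proof.
elim: n => [|n IH]; first by rewrite !big_ord0 mulr0 subrr.
by rewrite !big_ord_recr /= IH; ring.
Qed.

(** Adds the tangent inequalities at the midpoint for [x] and for [y]. *)
Lemma powR_midpoint q x y : 1 <= q -> 0 <= x -> 0 <= y ->
  ((x + y) / 2) `^ q <= (x `^ q + y `^ q) / 2.
Proof.
move=> q1 x0 y0; have m0 : 0 <= (x + y) / 2 by lra.
have h1 := young_tangent q1 m0 x0; have h2 := young_tangent q1 m0 y0.
have h3 := mulr_powRB1 m0 (lt_le_trans ltr01 q1); move: h1 h2 h3.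
set m := (x + y) / 2; set c := m `^ (q - 1); set d := m `^ q => h1 h2 h3.
have e1 : x + y = 2 * m by rewrite /m; field.
have q0 : 0 < q by lra.
have h4 : d * q^-1 <= (x `^ q + y `^ q) / 2 * q^-1.
  have : c * x + c * y = 2 * d by rewrite -mulrDr e1 -h3; ring.
  by lra.
by rewrite ler_pM2r ?invr_gt0 // in h4.
Qed.

End PowerInequalities.

(** * Schatten norms tested on orthonormal families *)

Section SchattenInequalities.
Context {R : realType} {H : hilbertType R}.
Implicit Types (x y z : H) (B : set H) (s : seq H) (T S K : H -> H) (p c M : R).

Lemma esumZl_le B (f : H -> R) c : 0 <= c ->
  (\esum_(b in B) (c * f b)%:E <= c%:E * \esum_(b in B) (f b)%:E)%E.
Proof.
move=> c0; apply: esum_fam_le => s fs.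
rewrite sumEFin -mulr_sumr EFinM lee_wpmul2l ?lee_fin //.
by rewrite -sumEFin esum_fam_ub.
Qed.

Lemma esumZl B (f : H -> R) c : 0 <= c ->
  (\esum_(b in B) (c * f b)%:E = c%:E * \esum_(b in B) (f b)%:E)%E.
Proof.
move=> c0; apply/eqP; rewrite eq_le esumZl_le //=.
have [->|cn] := eqVneq c 0.
  by rewrite mul0e esum_ge0 // => b _; rewrite mul0r.
have cp : 0 < c by rewrite lt0r cn.
have := @esumZl_le B (fun b => c * f b) c^-1; rewrite invr_ge0 => /(_ c0).
under eq_esum do rewrite mulrA mulVf // mul1r.
move/(lee_wpmul2l (_ : 0 <= c%:E)%E) => h; apply: le_trans (h _) _.
  by rewrite lee_fin.
by rewrite muleA -EFinM mulfV // mul1e.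
Qed.

(** [K] and its modulus give the same norms, and the modulus is diagonal in [B], so Parseval
    applies. *)
Lemma nsq_singular K B x : bop K -> ucompact K -> singular_basis K B ->
  (\esum_(b in B) (nsq (K b) * csq (inner x b))%:E = (nsq (K x))%:E)%E.
Proof.
move=> bK cK sB; have [[lS _] pS SS] := modulus_spec bK cK.
have sS := positive_symmetric lS pS.
have -> : nsq (K x) = nsq (modulus K x).
  by rewrite /nsq sS SS -adjointP.
rewrite -(parseval _ (proj1 sB)); apply: eq_esum => b Bb; congr (_%:E).
by rewrite sS (modulus_singular bK cK sB Bb) innerZr conjCR csqM csqR -nsqE.
Qed.

Lemma powR_nr p x : nsq x `^ (p / 2) = nr x `^ p.
Proof.
have -> : nsq x = nr x `^ 2 by rewrite nsqE powR_mulrn ?nr_ge0.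
by rewrite -powRrM mulrC divfK.
Qed.

(* Jensen's inequality for the probability weights [|<x, b>|^2] *)
Lemma schatten_jensen K B p x : 2 <= p -> bop K -> ucompact K -> singular_basis K B ->
  nsq x = 1 ->
  ((nr (K x) `^ p)%:E <= \esum_(b in B) (nr (K b) `^ p * csq (inner x b))%:E)%E.
Proof.
move=> p2 bK cK sB x1; have q1 : 1 <= p / 2 by lra.
set q := p / 2 in q1; have q0 : 0 < q by lra.
set t := nsq (K x); have t0 : 0 <= t by exact: nsq_ge0.
rewrite -powR_nr -/q -/t; set E := esum _ _.
have pt : 0 <= (1 - q^-1) * t `^ q.
  by rewrite mulr_ge0 ?powR_ge0 // subr_ge0 invf_le1.
have := @esumZl B (fun b => nsq (K b) * csq (inner x b)) (t `^ (q - 1)) (powR_ge0 _ _).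
rewrite nsq_singular // -/t -EFinM mulrC mulr_powRB1 // => h.
(* Tangent inequality at [t = |K x|^2], weighted by [|<x, b>|^2] and summed over [b]; the weights
   add up to 1. *)
have : ((t `^ q)%:E <= q^-1%:E * E + ((1 - q^-1) * t `^ q)%:E)%E.
  have -> : ((1 - q^-1) * t `^ q)%:E =
      (\esum_(b in B) ((1 - q^-1) * t `^ q * csq (inner x b))%:E)%E.
    by rewrite esumZl // (parseval x (proj1 sB)) x1 mule1.
  rewrite -h /E -esumZl ?invr_ge0 ?(ltW q0) // -esumD.
  - apply: le_esum => b _; rewrite lee_fin -powR_nr -/q.
    have := young_tangent q1 t0 (nsq_ge0 (K b)).
    by have := csq_ge0 (inner x b); nra.
  - by move=> b _; rewrite lee_fin !mulr_ge0 ?powR_ge0 ?csq_ge0 // invr_ge0 ltW.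
  - by move=> b _; rewrite lee_fin mulr_ge0 ?csq_ge0.
have : (0 <= E)%E by apply: esum_ge0 => b _; rewrite lee_fin mulr_ge0 ?powR_ge0 ?csq_ge0.
case: E => [r| |] //= r0; last by rewrite leey.
rewrite -EFinM -EFinD !lee_fin => h1.
have : t `^ q * q^-1 <= r * q^-1 by lra.
by rewrite ler_pM2r // invr_gt0.
Qed.

(** Jensen for each [e], then an exchange of sums and Bessel for [b] along [s]. *)
Lemma schatten_ons K B p s : 2 <= p -> bop K -> ucompact K -> singular_basis K B ->
  ons s -> ((\sum_(e <- s) nr (K e) `^ p)%:E <= \esum_(b in B) (nr (K b) `^ p)%:E)%E.
Proof.
move=> p2 bK cK sB os.
apply: (@le_trans _ _ (\sum_(e <- s) \esum_(b in B) (nr (K b) `^ p * csq (inner e b))%:E)%E).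
  rewrite -sumEFin big_seq [leRHS]big_seq; apply: lee_sum => e es.
  by apply: schatten_jensen => //; apply: nsq_ons es.
rewrite -esum_sum; last by move=> b e _ _; rewrite lee_fin mulr_ge0 ?powR_ge0 ?csq_ge0.
apply: le_esum => b Bb; rewrite sumEFin lee_fin -mulr_sumr.
rewrite -[leRHS]mulr1 ler_wpM2l ?powR_ge0 //.
have b1 : nsq b = 1 by rewrite /nsq (proj1 (proj1 sB)) // eqxx.
rewrite -b1; under eq_bigr do rewrite csq_innerC.
exact: bessel.
Qed.

Lemma schatten_le K B p M : 0 < p -> bop K -> ucompact K -> singular_basis K B ->
  0 <= M -> (forall s, fam B s -> \sum_(b <- s) nr (K b) `^ p <= M `^ p) ->
  (schatten_norm p K <= M%:E)%E.
Proof.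
move=> p0 bK cK sB M0 h; rewrite (schatten_normE p0 bK cK sB).
have := esum_real_fam_le h.
have : (0 <= \esum_(b in B) (nr (K b) `^ p)%:E)%E.
  by apply: esum_ge0 => b _; rewrite lee_fin powR_ge0.
case: (esum _ _) => [r| |] //; rewrite !lee_fin => r0 rM.
have -> : M = (M `^ p) `^ p^-1 by rewrite -powRrM mulfV ?gt_eqF // powRr1.
by rewrite ge0_ler_powR ?nnegrE ?powR_ge0 // invr_ge0 ltW.
Qed.

(** Together with [schatten_le], which needs a single singular basis, this converts between extended
    norms and finite real sums. *)
Lemma schatten_ge K p M s : 2 <= p -> bop K -> ucompact K ->
  (schatten_norm p K <= M%:E)%E -> ons s -> \sum_(e <- s) nr (K e) `^ p <= M `^ p.
Proof.
move=> p2 bK cK; have p0 : 0 < p by lra.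
have [B sB] := singular_basis_exists bK cK; rewrite (schatten_normE p0 bK cK sB) => h os.
rewrite -lee_fin; apply: le_trans (schatten_ons p2 bK cK sB os) _; move: h.
have : (0 <= \esum_(b in B) (nr (K b) `^ p)%:E)%E.
  by apply: esum_ge0 => b _; rewrite lee_fin powR_ge0.
case: (esum _ _) => [r| |] //.
  rewrite !lee_fin => r0 rM.
  have -> : r = (r `^ p^-1) `^ p by rewrite -powRrM mulVf ?gt_eqF // powRr1.
  rewrite ge0_ler_powR ?nnegrE ?powR_ge0 //; first exact: ltW.
  exact: le_trans (powR_ge0 _ _) rM.
by rewrite poweRyr ?leye_eq // invr_neq0 // gt_eqF.
Qed.

(** An eigenbasis of [K] is also a singular basis, and there [|K b|] is the modulus of the
    eigenvalue. *)
Lemma symmetric_singular_basis K : bop K -> ucompact K -> symmetric_operator K ->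
  exists B, singular_basis K B /\
    forall b, B b -> nr (K b) = `|Re (inner (K b) b)|.
Proof.
move=> bK cK sK; have [B [d [oB hd]]] := spectral bK cK sK; have [lK _] := bK.
have b1 b : B b -> nsq b = 1 by move=> Bb; rewrite /nsq (proj1 oB) // eqxx.
exists B; split.
  split=> // b Bb; rewrite symmetric_adjoint // (hd b Bb) (linearfZ lK) (hd b Bb) scalerA.
  by rewrite nsqZ b1 // mulr1 csqR -rmorphM -expr2.
move=> b Bb; rewrite hd // innerZl inner_nsq b1 // nr_sqrt nsqZ b1 // mulr1 csqR.
by rewrite sqrtr_sqr /= !mulr0 subr0 mulr1.
Qed.

Lemma re_operatorE T x : bop T -> inner (re_operator T x) x = (Re (inner (T x) x))%:C%C.
Proof.
move=> bT; rewrite innerZl innerDl adjointPl // (innerJ (T x) x).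
by apply: eqC; rewrite !reimE /=; field.
Qed.

Lemma re_operator_bop T : bop T -> bop (re_operator T).
Proof. by move=> bT; apply: bopZ; apply: bopD => //; apply: bop_adjoint_bop. Qed.

Lemma re_operator_ucompact T : bop T -> ucompact T -> ucompact (re_operator T).
Proof. by move=> bT cT; apply: ucompactZ; apply: ucompactD => //; apply: ucompact_adjoint. Qed.

Lemma re_operator_symmetric T : bop T -> symmetric_operator (re_operator T).
Proof.
move=> bT x y; rewrite innerZl innerZr innerDl innerDr adjointPl // adjointP //.
by rewrite addrC; congr (_ * _); rewrite -[2^-1]/(2^-1) fmorphV rmorph_nat.
Qed.

(* For an eigenvector [b] of [Re T], [|Re T b| = |Re <T b, b>| <= |T b|]. *)
Lemma schatten_re_le T p M : 2 <= p -> bop T -> ucompact T -> 0 <= M ->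
  (forall s, ons s -> \sum_(b <- s) nr (T b) `^ p <= M `^ p) ->
  (schatten_norm p (re_operator T) <= M%:E)%E.
Proof.
move=> p2 bT cT M0 h; have p0 : 0 < p by lra.
have bK := re_operator_bop bT; have cK := re_operator_ucompact bT cT.
have [B [sB hB]] := symmetric_singular_basis bK cK (re_operator_symmetric bT).
apply: (schatten_le p0 bK cK sB M0) => s fs.
apply: le_trans (h s (ons_fam (proj1 (proj1 sB)) fs)).
rewrite big_seq [leRHS]big_seq; apply: ler_sum => b bs.
have Bb : B b by case: fs => _; apply.
rewrite ge0_ler_powR ?nnegrE ?nr_ge0 ?(ltW p0) // hB // re_operatorE //=.
apply: le_trans (Re_inner_le _ _) _.
rewrite [nr b]nr_sqrt; have -> : nsq b = 1 by rewrite /nsq (proj1 (proj1 sB)) // eqxx.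
by rewrite sqrtr1 mulr1.
Qed.

End SchattenInequalities.

(** * Cartesian decompositions *)

Section CartesianDecomposition.
Context {R : realType} {H : hilbertType R}.
Implicit Types (x y z e f : H) (B : set H) (s h : seq H) (T S K P : H -> H) (a : R[i]).

(** Diagonal in an eigenbasis of [P], with the square roots of the eigenvalues. *)
Lemma symmetric_sqrt P : bop P -> ucompact P -> positive_operator P ->
  exists S, [/\ bop S, symmetric_operator S & forall x, S (S x) = P x].
Proof.
move=> bP cP pP; have [lP _] := bP; have sP := positive_symmetric lP pP.
have [B [d [oB hd]]] := spectral bP cP sP.
have b1 b : B b -> nsq b = 1 by move=> Bb; rewrite /nsq (proj1 oB) // eqxx.
have [C C0 hC] := bop_nr_le bP.
have dE b : B b -> 0 <= d b /\ nr (P b) = d b.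
  move=> Bb; have d0 : 0 <= d b.
    by have := pP b; rewrite hd // innerZl inner_nsq b1 // mulr1 lecR.
  by split=> //; rewrite hd // nr_sqrt nsqZ b1 // mulr1 csqR sqrtr_sqr ger0_norm.
have [|S bS hS] := @diag_operator R H B (fun b => Num.sqrt (d b)) (Num.sqrt C) oB.
  move=> b Bb; have [d0 dP] := dE b Bb.
  by rewrite sqrtr_ge0 ler_wsqrtr // -dP hC // b1.
have SB := diag_basis oB hS; have [lS _] := bS.
exists S; split=> // [|x]; first exact: diag_symmetric SB.
suff : S \o S = P by move/(congr1 (fun g => g x)).
apply: (bop_eq oB) => // [|b Bb]; first exact: bop_comp.
have [d0 _] := dE b Bb.
rewrite /= (SB b Bb) (linearfZ lS) (SB b Bb) scalerA -rmorphM -expr2 sqr_sqrtr //.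
by rewrite hd.
Qed.

Lemma re_operatorZ T a x : bop T ->
  re_operator (fun x => a *: T x) x = 2^-1 *: (a *: T x + a^* *: adjoint T x).
Proof.
move=> bT; rewrite /re_operator (@adjoint_unique _ _ _ (fun x => a^* *: adjoint T x)) //.
by move=> y z; rewrite innerZl innerZr adjointP // conjCK.
Qed.

(** [Im T] is written as the real part of [- i T], the form in which the numerical radius controls
    it. *)
Lemma cartesianE T x : bop T ->
  T x = re_operator T x + 'i%C *: re_operator (fun x => - 'i%C *: T x) x.
Proof.
move=> bT; rewrite re_operatorZ // /re_operator !scalerDr !scalerA.
have iJ : (- 'i%C)^* = 'i%C :> R[i] by apply: eqC; rewrite !reimE /=; ring.
have i2 : 'i%C * 'i%C = -1 :> R[i] by apply: eqC; rewrite !reimE /=; ring.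
rewrite iJ mulrAC mulrN i2 opprK mul1r [_ * 'i%C]mulrAC i2 mulN1r scaleNr.
by rewrite addrACA addrN addr0 -scalerDl -[2^-1]mul1r -splitr scale1r.
Qed.

Lemma re_operatorZE T a x : bop T ->
  inner (re_operator (fun x => a *: T x) x) x = (Re (a * inner (T x) x))%:C%C.
Proof. by move=> bT; rewrite re_operatorE ?innerZl //; apply: bopZ. Qed.

(** Expands [0 <= <P (x - y), x - y>]. *)
Lemma positive_re_le P x y : symmetric_operator P -> linear P -> positive_operator P ->
  Re (inner (P x) y) <= (Re (inner (P x) x) + Re (inner (P y) y)) / 2.
Proof.
move=> sP lP pP; have := pP (x - y).
have h : inner (P y) x = (inner (P x) y)^* by rewrite sP innerJ.
rewrite lecE => /andP[_]; rewrite (linearfB lP) !innerBl !innerBr h !reimE /=.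
by lra.
Qed.

(** Uses [positive_re_le] for the real part at [e], [f] and for the imaginary part at [e], [- i f];
    the phase absorbs the factor [i] and leaves the quadratic form at [f] unchanged. *)
Lemma numerical_range_bound T e f : bop T ->
  (forall x, 0 <= Re (inner (T x) x)) -> (forall x, 0 <= Im (inner (T x) x)) ->
  Re (inner (T e) f) <= (Re (inner (T e) e) + Im (inner (T e) e) +
                         (Re (inner (T f) f) + Im (inner (T f) f))) / 2.
Proof.
move=> bT hR hI; have biT := bopZ (- 'i%C) bT.
set A := re_operator T; set B := re_operator (fun x => - 'i%C *: T x).
have AE x : inner (A x) x = (Re (inner (T x) x))%:C%C by rewrite re_operatorE.
have BE x : inner (B x) x = (Im (inner (T x) x))%:C%C.
  by rewrite re_operatorZE // !reimE /=; congr (_%:C%C); ring.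
have lA : linear A by case: (re_operator_bop bT).
have lB : linear B by case: (re_operator_bop biT).
have sA : symmetric_operator A := re_operator_symmetric bT.
have sB : symmetric_operator B := re_operator_symmetric biT.
have TE : T e = A e + 'i%C *: B e := cartesianE e bT.
have pA : positive_operator A by move=> x; rewrite AE lecR.
have pB : positive_operator B by move=> x; rewrite BE lecR.
move: AE BE lA lB sA sB TE pA pB; clearbody A B => AE BE lA lB sA sB TE pA pB.
have hA := positive_re_le e f sA lA pA.
have hB := positive_re_le e (- 'i%C *: f) sB lB pB.
have -> : Re (inner (T e) f) = Re (inner (A e) f) + Re (inner (B e) (- 'i%C *: f)).
  by rewrite TE innerDl innerZl innerZr !reimE /=; ring.
move: hA hB; rewrite !AE (linearfZ lB) !innerZl !innerZr !BE !reimE /=.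
by lra.
Qed.

(** These are left singular vectors: [<T e, T f> = <T^* T e, f>] vanishes for distinct [e] and
    [f]. *)
Lemma polar_ons T B s : bop T -> singular_basis T B -> fam B s ->
  (forall e, e \in s -> nr (T e) != 0) -> ons (map (fun e => unit_of (T e)) s).
Proof.
move=> bT [oB hB] [us sB] s0.
have inn e f : e \in s -> f \in s ->
    inner (unit_of (T e)) (unit_of (T f)) = (e == f)%:R.
  move=> es fs; rewrite innerZl innerZr -adjointPl // hB; last exact: sB.
  rewrite innerZl conjCR (proj1 oB); [|exact: sB|exact: sB].
  case: eqP => [->|]; last by rewrite !mulr0.
  rewrite mulr1 -!rmorphM nsqE -[RHS]/(1%:C%C); congr (_%:C%C).
  by field; exact: s0.
have inj : {in s &, injective (fun e => unit_of (T e))}.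
  move=> e f es fs ef; apply/eqP; apply/negPn/negP => /negbTE nef.
  have := inn e f es fs; rewrite -ef inn // eqxx nef.
  by move/(congr1 (@complex.Re R))/eqP; rewrite /= oner_eq0.
split; first by rewrite map_inj_in_uniq.
move=> _ _ /mapP[e es ->] /mapP[f fs ->]; rewrite inn //.
by congr ((_ : bool)%:R); apply/eqP/eqP => [->//|/inj]; apply.
Qed.

(** Pairs [e] with [u = T e / |T e|], for which [|T e| = <T e, u>]. The numerical range bound and
    convexity of the power leave one sum over the [e] and one over the [u], both orthonormal. *)
Lemma schatten_sector T a B (p w : R) : 1 <= p -> 0 <= w -> bop T -> singular_basis T B ->
  (forall x, 0 <= Re (inner (T x) x)) -> (forall x, 0 <= Im (inner (T x) x)) ->
  (forall c : R[i], Re c + Im c = Num.sqrt 2 * Re (a * c)) ->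
  (forall s, ons s -> \sum_(e <- s) nr (re_operator (fun x => a *: T x) e) `^ p <= w `^ p) ->
  forall s, fam B s -> \sum_(e <- s) nr (T e) `^ p <= (Num.sqrt 2 * w) `^ p.
Proof.
move=> p1 w0 bT sB hR hI ha hw s fs; have [us sBs] := fs.
set A := re_operator _ in hw.
have p0 : 0 < p by lra.
(* Vectors in the kernel contribute nothing and have no left singular vector. *)
set s' := [seq e <- s | nr (T e) != 0].
have fs' : fam B s'.
  split; first exact: filter_uniq.
  by move=> e; rewrite mem_filter => /andP[_ /sBs].
have os' := ons_fam (proj1 (proj1 sB)) fs'.
have s'0 e : e \in s' -> nr (T e) != 0 by rewrite mem_filter => /andP[].
have og := polar_ons bT sB fs' s'0.
rewrite (bigID (fun e => nr (T e) != 0)) /= [X in _ + X]big1 ?addr0; last first.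
  by move=> e; rewrite negbK => /eqP ->; rewrite powR0 // gt_eqF.
rewrite -big_filter -/s'.
pose u e := unit_of (T e).
have rho x : nsq x = 1 -> Re (inner (T x) x) + Im (inner (T x) x) <= Num.sqrt 2 * nr (A x).
  move=> x1; rewrite ha ler_wpM2l ?sqrtr_ge0 //.
  have := Re_inner_le (A x) x; rewrite re_operatorZE //= [nr x]nr_sqrt x1 sqrtr1 mulr1.
  exact: le_trans (ler_norm _).
have step e : e \in s' -> nr (T e) `^ p <=
    Num.sqrt 2 `^ p * ((nr (A e) `^ p + nr (A (u e)) `^ p) / 2).
  move=> es; have Te0 := s'0 e es.
  have u1 : nsq (u e) = 1 by apply: nsq_unit_of; rewrite nsqE expf_neq0.
  have e1 : nsq e = 1 by apply: nsq_ons es.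
  have h1 := numerical_range_bound e (u e) bT hR hI.
  have h2 := rho e e1; have h3 := rho (u e) u1.
  have TE : inner (T e) (u e) = (nr (T e))%:C%C.
    rewrite innerZr conjCR inner_nsq nsqE -rmorphM /= expr2 mulrA mulVf // mul1r //.
  have h4 : nr (T e) <= Num.sqrt 2 * ((nr (A e) + nr (A (u e))) / 2).
    by move: h1; rewrite TE /=; lra.
  apply: (@le_trans _ _ ((Num.sqrt 2 * ((nr (A e) + nr (A (u e))) / 2)) `^ p)).
    by rewrite ge0_ler_powR ?nnegrE ?nr_ge0 ?(ltW p0) // (le_trans (nr_ge0 _) h4).
  rewrite powRM ?sqrtr_ge0 //; last by rewrite divr_ge0 // addr_ge0 ?nr_ge0.
  by rewrite ler_wpM2l ?powR_ge0 // powR_midpoint ?nr_ge0.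
apply: (@le_trans _ _ (\sum_(e <- s') Num.sqrt 2 `^ p * ((nr (A e) `^ p + nr (A (u e)) `^ p) / 2))).
  by rewrite big_seq [leRHS]big_seq; apply: ler_sum.
rewrite -mulr_sumr powRM ?sqrtr_ge0 // ler_wpM2l ?powR_ge0 //.
rewrite -mulr_suml big_split /=.
have h1 := hw _ os'; have := hw _ og; rewrite big_map => h2.
by move: h1 h2; rewrite -/A /u; lra.
Qed.

End CartesianDecomposition.

(** * Hilbert-Schmidt estimates on finite spans and a weighted Ky Fan inequality *)

Section AccretiveBound.
Context {R : realType} {H : hilbertType R}.
Implicit Types (x y z e f : H) (B : set H) (s h : seq H) (T S K P : H -> H).

(* Twice the Hilbert-Schmidt norm squared of [K] on the span of [s], minus that
   of its compression to this span. *)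
Definition gap K s : R := 2 * \sum_(e <- s) nsq (K e) -
  \sum_(e <- s) \sum_(f <- s) csq (inner (K e) f).

(** Residuals orthogonal to [s] are bounded by the parallelogram law. Inside the span,
    [|<T e, f>|^2] is expanded exactly, and its cross terms [2 X e f] cancel by antisymmetry. *)
Lemma gap_cartesian T P S s : ons s -> symmetric_operator P -> symmetric_operator S ->
  (forall x, T x = P x + 'i%C *: S x) ->
  \sum_(e <- s) nsq (T e) <= gap P s + gap S s.
Proof.
move=> os sP sS hT.
pose X e f := Im (inner (P e) f) * Re (inner (S e) f) - Re (inner (P e) f) * Im (inner (S e) f).
have X0 : \sum_(e <- s) \sum_(f <- s) X e f = 0.
  have anti : \sum_(e <- s) \sum_(f <- s) X e f = - \sum_(e <- s) \sum_(f <- s) X e f.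
    rewrite [LHS]exchange_big /= -sumrN; apply: eq_bigr => e _; rewrite -sumrN.
    apply: eq_bigr => f _; rewrite /X (sP f) (sS f) (innerJ (P e)) (innerJ (S e)).
    by rewrite !reimE; ring.
  by lra.
have csqT e f : csq (inner (T e) f) =
    csq (inner (P e) f) + csq (inner (S e) f) + 2 * X e f.
  by rewrite hT innerDl innerZl /csq /X !reimE /=; ring.
have bound e : nsq (T e) <= 2 * nsq (P e) + 2 * nsq (S e) + \sum_(f <- s) (2 * X e f)
    - \sum_(f <- s) csq (inner (P e) f) - \sum_(f <- s) csq (inner (S e) f).
  have hTe := nsq_fsumB (T e) os; have hPe := nsq_fsumB (P e) os.
  have hSe := nsq_fsumB (S e) os.
  have iR c : nsq ('i%C *: c : H) = nsq c by rewrite nsqZ /csq /= expr0n expr1n add0r mul1r.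
  have TPS : T e - fsum s (inner (T e)) = (P e - fsum s (inner (P e))) +
      'i%C *: (S e - fsum s (inner (S e))).
    rewrite {1}hT scalerBr [RHS]addrACA -opprD; congr (_ - _).
    rewrite /fsum scaler_sumr -big_split /=; apply: eq_bigr => f _.
    by rewrite hT innerDl innerZl scalerDl scalerA.
  have := nsqD_le (P e - fsum s (inner (P e))) ('i%C *: (S e - fsum s (inner (S e)))).
  rewrite -TPS iR hTe hPe hSe.
  have -> : \sum_(b <- s) csq (inner (T e) b) = \sum_(f <- s) csq (inner (P e) f) +
      \sum_(f <- s) csq (inner (S e) f) + \sum_(f <- s) (2 * X e f).
    by rewrite -!big_split /=; apply: eq_bigr => f _; apply: csqT.
  by lra.
apply: (@le_trans _ _ _ _ _ (ler_sum _ (fun e _ => bound e))).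
rewrite !big_split /= !sumrN -!mulr_sumr /gap.
have -> : \sum_(e <- s) \sum_(f <- s) 2 * X e f = 0.
  by under eq_bigr do rewrite -mulr_sumr; rewrite -mulr_sumr X0 mulr0.
by lra.
Qed.

(** [h] is an orthonormal basis [s ++ g] of the span of [s] and its image. The gap exceeds the sum
    of [|S e|^2] over [s] by the entries of [S] between [s] and [g], which symmetry and Bessel bound
    by the sum over [g]. *)
Lemma gap_symmetric S s : ons s -> symmetric_operator S ->
  exists h, [/\ ons h, (size h <= 2 * size s)%N & gap S s <= \sum_(x <- h) nsq (S x)].
Proof.
move=> os sS; have [g [og sg vg]] := gram_schmidt (map S s) os.
exists (s ++ g); split=> //.
  by move: sg; rewrite size_map size_cat mul2n -addnn leq_add2l.
have og' : ons g.
  apply: (ons_sub _ _ og); last by move=> b bg; rewrite mem_cat bg orbT.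
  by case: og; rewrite cat_uniq => /and3P[].
have nS e : e \in s -> nsq (S e) = \sum_(f <- s) csq (inner (S e) f) +
    \sum_(f <- g) csq (inner (S e) f).
  move=> es; rewrite {1}(vg (S e)) ?map_f // nsq_fsum //.
  by rewrite big_cat.
have E : \sum_(e <- s) \sum_(f <- g) csq (inner (S e) f) <= \sum_(f <- g) nsq (S f).
  rewrite exchange_big /=; apply: ler_sum => f _.
  apply: le_trans (bessel (S f) os); apply: ler_sum => e _.
  by rewrite sS csq_innerC.
rewrite big_cat /= /gap.
have : \sum_(e <- s) nsq (S e) = \sum_(e <- s) \sum_(f <- s) csq (inner (S e) f) +
    \sum_(e <- s) \sum_(f <- g) csq (inner (S e) f).
  by rewrite -big_split /= big_seq [RHS]big_seq; apply: eq_bigr.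
by lra.
Qed.

Lemma conjC_sum I (r : seq I) (F : I -> R[i]) :
  (\sum_(i <- r) F i)^* = \sum_(i <- r) (F i)^*.
Proof. exact: rmorph_sum. Qed.

Lemma sumC I (r : seq I) (F : I -> R) :
  (\sum_(i <- r) F i)%:C%C = \sum_(i <- r) (F i)%:C%C.
Proof. exact: rmorph_sum. Qed.

(** For the matrix [C] of entries [c l e], the Gram matrices [C C^*] and [C^* C] have the same
    Hilbert-Schmidt norm: both squares expand to one fourfold sum. *)
Lemma sum_csq_gram (I J : Type) (r : seq I) (t : seq J) (c : I -> J -> R[i]) :
  \sum_(l <- r) \sum_(m <- r) csq (\sum_(e <- t) c l e * (c m e)^* ) =
  \sum_(e <- t) \sum_(f <- t) csq (\sum_(l <- r) c l f * (c l e)^* ).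
Proof.
apply: (@complexI R); rewrite !sumC.
transitivity (\sum_(l <- r) \sum_(m <- r) \sum_(e <- t) \sum_(f <- t)
    (c l e * (c m e)^* * ((c l f)^* * c m f))).
  apply: eq_bigr => l _; rewrite sumC; apply: eq_bigr => m _.
  rewrite -csqE conjC_sum big_distrlr /=; apply: eq_bigr => e _.
  by apply: eq_bigr => f _; rewrite rmorphM /= conjCK.
under eq_bigr do rewrite exchange_big /=.
rewrite exchange_big /=; apply: eq_bigr => e _; rewrite sumC.
under eq_bigr do rewrite exchange_big /=.
rewrite exchange_big /=; apply: eq_bigr => f _.
rewrite -csqJ -csqE conjCK conjC_sum big_distrlr /=.
apply: eq_bigr => l _; apply: eq_bigr => m _.
by rewrite rmorphM /= conjCK; ring.
Qed.

(* Expands [0 <= \sum_(l, m) |M l m - D l m|^2] for the Gram matrix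
   [M l m = <S l, S m>] and [D l m = \sum_e <S l, e> <e, S m>], which is the Gram
   matrix of the projections of the [S l] on the span of [s]. *)
Lemma gap_positive P S s : ons s -> linear S -> symmetric_operator S -> (forall x, S (S x) = P x) ->
  exists h, [/\ ons h, (size h <= size s)%N & gap P s <= \sum_(x <- h) nsq (P x)].
Proof.
move=> os lS sS SP.
have o0 : ons ([::] : seq H) by split.
have [h [/= oh sh vh]] := gram_schmidt (map S s) o0.
exists h; split=> //; first by rewrite size_map in sh.
have Ph x y : inner (S x) (S y) = inner (P x) y by rewrite -sS SP.
pose c l e := inner (S l) e.
pose D l m := \sum_(e <- s) c l e * (c m e)^*.
have PE e : e \in s -> P e = \sum_(l <- h) (c l e)^* *: S l.
  move=> es; rewrite -SP {1}(vh (S e)) ?map_f // linearf_fsum //.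
  by apply: eq_bigr => l _; rewrite [inner (S e) l]innerJ -sS.
(* The other Gram matrix attached to [c] is, up to the order of indices, the compression of [P] to
   the span of [s]. *)
have DD : \sum_(l <- h) \sum_(m <- h) csq (D l m) =
    \sum_(e <- s) \sum_(f <- s) csq (inner (P e) f).
  rewrite sum_csq_gram big_seq [RHS]big_seq; apply: eq_bigr => e es.
  apply: eq_bigr => f _; rewrite (PE e es) inner_suml; congr (csq _).
  by apply: eq_bigr => l _; rewrite innerZl mulrC.
have MD : \sum_(l <- h) \sum_(m <- h) Re (inner (S l) (S m) * (D l m)^* ) =
    \sum_(e <- s) nsq (P e).
  transitivity (\sum_(l <- h) \sum_(m <- h) \sum_(e <- s)
      Re (inner (S l) (S m) * ((c l e)^* * c m e))).
    apply: eq_bigr => l _; apply: eq_bigr => m _.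
    rewrite conjC_sum mulr_sumr Re_sum; apply: eq_bigr => e _.
    by rewrite rmorphM /= conjCK.
  under eq_bigr do rewrite exchange_big /=.
  rewrite exchange_big /= big_seq [RHS]big_seq; apply: eq_bigr => e es.
  rewrite /nsq (PE e es) inner_suml Re_sum; apply: eq_bigr => l _.
  rewrite inner_sumr Re_sum; apply: eq_bigr => m _.
  by rewrite innerZl innerZr conjCK; congr (Re _); ring.
(* Nonnegativity reads [2 Re <M, D> - |D|^2 <= |M|^2], whose left side is [gap P s]; Bessel bounds
   the right side. *)
have : 0 <= \sum_(l <- h) \sum_(m <- h) csq (inner (S l) (S m) - D l m).
  by apply: sumr_ge0 => l _; apply: sumr_ge0 => m _; apply: csq_ge0.
have -> : \sum_(l <- h) \sum_(m <- h) csq (inner (S l) (S m) - D l m) =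
    \sum_(l <- h) \sum_(m <- h) csq (inner (S l) (S m)) +
    \sum_(l <- h) \sum_(m <- h) csq (D l m) -
    2 * \sum_(l <- h) \sum_(m <- h) Re (inner (S l) (S m) * (D l m)^* ).
  rewrite mulr_sumr -big_split -sumrB /=; apply: eq_bigr => l _.
  rewrite mulr_sumr -big_split -sumrB /=; apply: eq_bigr => m _.
  by rewrite /csq !reimE; ring.
rewrite DD MD /gap => h0.
have : \sum_(l <- h) \sum_(m <- h) csq (inner (S l) (S m)) <= \sum_(l <- h) nsq (P l).
  apply: ler_sum => l _; apply: le_trans (bessel (P l) oh).
  by apply: ler_sum => m _; rewrite Ph.
by lra.
Qed.

Lemma dual_power_homo q (y : nat -> R) n k : 1 <= q -> (forall j, 0 <= y j) ->
  (forall j, y j.+1 <= y j) -> dual_power q y n k.+1 <= dual_power q y n k.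
Proof.
move=> q1 y0 yd.
have c0 : 0 <= 1 - q^-1 by rewrite subr_ge0 invf_le1 //; lra.
rewrite /dual_power; case: ifP => [kn|_].
  rewrite (ltn_trans (ltnSn k) kn) ler_wpM2l // ge0_ler_powR ?nnegrE //.
  by lra.
by case: ifP => // _; rewrite mulr_ge0 ?powR_ge0.
Qed.

Lemma weight_homo q (y : nat -> R) n k : 1 <= q -> (forall j, 0 <= y j) ->
  (forall j, y j.+1 <= y j) -> weight q y n k.+1 <= weight q y n k.
Proof.
move=> q1 y0 yd; rewrite /weight; case: ifP => [kn|_].
  by rewrite (ltn_trans (ltnSn k) kn) powR_pred_homo.
by case: ifP => // _; rewrite powR_ge0.
Qed.

(* Ky Fan's maximum principle and Hoelder's inequality in one stroke, in the
   form of Young's inequality. *)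
Lemma weighted_ky_fan K B p w q (y : nat -> R) n m (h : nat -> seq H) c :
  2 <= p -> q = p / 2 -> bop K -> ucompact K -> singular_basis K B ->
  (forall s, ons s -> \sum_(e <- s) nr (K e) `^ p <= w) ->
  (forall j, 0 <= y j) -> (forall j, y j.+1 <= y j) ->
  (forall k, ons (h k)) -> (forall k, (k < n)%N -> (size (h k) <= m * k.+1)%N) -> 0 <= c ->
  c * (\sum_(k < n) (weight q y n k - weight q y n k.+1) * \sum_(x <- h k) nsq (K x)) <=
  m%:R * (\sum_(j < n) (1 - q^-1) * y j `^ q) + c `^ q * w / q.
Proof.
move=> p2 qE bK cK sB hw y0 yd oh sh c0.
have q1 : 1 <= q by rewrite qE; lra.
have q0 : 0 < q by lra.
pose d k := weight q y n k - weight q y n k.+1.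
pose r k := dual_power q y n k - dual_power q y n k.+1.
have d0 k : 0 <= d k by rewrite subr_ge0 weight_homo.
have r0 k : 0 <= r k by rewrite subr_ge0 dual_power_homo.
have -> : c * (\sum_(k < n) d k * \sum_(x <- h k) nsq (K x)) =
    \sum_(k < n) \sum_(x <- h k) (c * d k) * nsq (K x).
  by rewrite mulr_sumr; apply: eq_bigr => k _; rewrite mulrA mulr_sumr.
(* Each [|K x|^2] is expanded along the singular basis and the sums are exchanged, leaving finite
   subfamilies [s] of [B]. *)
rewrite -lee_fin -sumEFin.
under eq_bigr => k _.
  rewrite -sumEFin; under eq_bigr => x _.
    rewrite EFinM -(nsq_singular x bK cK sB) -esumZl ?mulr_ge0 //; over.
  rewrite -esum_sum; last first.
    by move=> b x _ _; rewrite lee_fin !mulr_ge0 ?nsq_ge0 ?csq_ge0.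
  over.
rewrite -esum_sum; last first.
  move=> b k _ _; apply: sume_ge0 => x _.
  by rewrite lee_fin !mulr_ge0 ?nsq_ge0 ?csq_ge0.
under eq_esum => b _.
  under eq_bigr do rewrite sumEFin.
  rewrite sumEFin; over.
apply: esum_real_fam_le => s fs; have os := ons_fam (proj1 (proj1 sB)) fs.
(* Squared norm of the projection of [b] on the span of [h k]: for [b] in [s] it lies between 0 and
   1, and its sum over [s] is at most the size of [h k]. Ky Fan's principle rests on these two
   facts. *)
pose W k b := \sum_(x <- h k) csq (inner x b).
have W1 k b : b \in s -> W k b <= 1.
  move=> bs; rewrite -(nsq_ons os bs); apply: le_trans (bessel b (oh k)).
  by apply: ler_sum => x _; rewrite csq_innerC.
have W0 k b : 0 <= W k b by apply: sumr_ge0 => x _; apply: csq_ge0.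
have Wm k : (k < n)%N -> \sum_(b <- s) W k b <= m%:R * k.+1%:R.
  move=> kn; rewrite exchange_big /=; apply: (@le_trans _ _ (\sum_(x <- h k) 1)).
    rewrite big_seq [leRHS]big_seq; apply: ler_sum => x xh.
    by rewrite -(nsq_ons (oh k) xh) bessel.
  by rewrite big_const_seq count_predT iter_addr_0 -natrM ler_nat sh.
pose t b := c * nsq (K b).
have t0 b : 0 <= t b by rewrite mulr_ge0 ?nsq_ge0.
rewrite exchange_big /=.
(* For [0 <= W <= 1] one has [W u <= W r + max(0, u - r)]; the last term no longer involves
   [h k]. *)
have step k : (k < n)%N ->
    \sum_(b <- s) \sum_(x <- h k) c * d k * (nsq (K b) * csq (inner x b)) <=
    m%:R * (r k * k.+1%:R) + \sum_(b <- s) Num.max 0 (d k * t b - r k).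
  move=> kn; apply: (@le_trans _ _ (\sum_(b <- s) (W k b * r k + Num.max 0 (d k * t b - r k)))).
    rewrite big_seq [leRHS]big_seq; apply: ler_sum => b bs.
    have -> : \sum_(x <- h k) c * d k * (nsq (K b) * csq (inner x b)) = W k b * (d k * t b).
      by rewrite mulr_suml; apply: eq_bigr => x _; rewrite /t; ring.
    have m1 : 0 <= Num.max 0 (d k * t b - r k) by rewrite le_max lexx.
    have m2 : d k * t b - r k <= Num.max 0 (d k * t b - r k) by rewrite le_max lexx orbT.
    have := W1 k b bs; have := W0 k b; nra.
  by rewrite big_split /= lerD2r -mulr_suml mulrCA [leLHS]mulrC ler_wpM2l // Wm.
apply: (@le_trans _ _ (\sum_(k < n) (m%:R * (r k * k.+1%:R) +
    \sum_(b <- s) Num.max 0 (d k * t b - r k)))).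
  by apply: ler_sum => k _; apply: step.
rewrite big_split /= -mulr_sumr lerD //.
  apply: ler_wpM2l => //.
  (* Summation by parts against the constant sequence 1 recovers the sum of the [dual_power]
     terms. *)
  have -> : \sum_(k < n) r k * k.+1%:R =
      \sum_(k < n) (dual_power q y n k - dual_power q y n k.+1) * \sum_(j < k.+1) 1.
    by apply: eq_bigr => k _; rewrite sumr_const card_ord.
  rewrite (abel_sum _ (fun=> 1)) {2}/dual_power ltnn mul0r subr0.
  by apply: ler_sum => j _; rewrite mulr1 /dual_power ltn_ord.
rewrite exchange_big /=.
(* For each [b], the positive parts over all [k] together cost at most one term of Young's
   inequality. *)
apply: (@le_trans _ _ (\sum_(b <- s) (t b `^ q / q))).
  by apply: ler_sum => b _; apply: sum_positive_parts.
rewrite -mulr_suml ler_wpM2r ?invr_ge0 ?(ltW q0) //.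
apply: (@le_trans _ _ (c `^ q * \sum_(b <- s) nr (K b) `^ p)).
  rewrite mulr_sumr; apply: ler_sum => b _.
  by rewrite powRM ?nsq_ge0 // qE powR_nr.
by rewrite ler_wpM2l ?powR_ge0 // hw.
Qed.

End AccretiveBound.

(** * The Schatten bound for accretive operators *)

Section Main.
Context {R : realType} {H : hilbertType R}.
Implicit Types (x y z e f : H) (B : set H) (s h : seq H) (T S K P A X : H -> H).

(** Summation by parts of the gap estimates gives [sigma <= G1 + G2]. The Ky Fan bounds, scaled
    suitably, give [k G1 <= E] and [k G2 <= c E] with [k = 1 + c], so [k] cancels and [sigma <= E]
    remains. *)
Lemma schatten_accretive T P S B (p w : R) : 2 <= p -> 0 <= w -> bop T -> singular_basis T B ->
  bop P -> ucompact P -> positive_operator P -> bop S -> ucompact S -> symmetric_operator S ->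
  (forall x, T x = P x + 'i%C *: S x) ->
  (forall s, ons s -> \sum_(e <- s) nr (P e) `^ p <= w `^ p) ->
  (forall s, ons s -> \sum_(e <- s) nr (S e) `^ p <= w `^ p) ->
  forall s, fam B s ->
    \sum_(e <- s) nr (T e) `^ p <= (Num.sqrt (1 + 2 `^ (1 - 2 / p)) * w) `^ p.
Proof.
move=> p2 w0 bT sB bP cP pP bS cS sS TE hP hS s fs; have [lP _] := bP.
have sP := positive_symmetric lP pP; have [lT _] := bT.
pose leT x y := nsq (T y) <= nsq (T x).
pose s' := sort leT s; pose n := size s'.
(* The default vector 0 extends [y] by zeros from [n] on, so it is nonincreasing at every index. *)
pose y j := nsq (T (nth 0 s' j)).
have y0 j : 0 <= y j by exact: nsq_ge0.
have yd j : y j.+1 <= y j.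
  have [jn|nj] := ltnP j.+1 n; last by rewrite /y [X in T X](nth_default 0 nj) (linearf0 lT) nsq0 nsq_ge0.
  have srt : sorted leT s' by apply: sort_sorted => a b; rewrite /leT; exact: le_total.
  by move/(sortedP 0): srt => /(_ j jn).
have os : ons s' by apply: (ons_sub _ _ (ons_fam (proj1 (proj1 sB)) fs));
  [rewrite sort_uniq; case: fs | move=> b; rewrite mem_sort].
set q := p / 2; have q1 : 1 <= q by rewrite /q; lra.
have q0 : 0 < q by lra.
set c := 2 `^ (1 - 2 / p); set k := 1 + c.
have c0 : 0 <= c by exact: powR_ge0.
have k0 : 0 < k by rewrite /k; lra.
have -> : \sum_(e <- s) nr (T e) `^ p = \sum_(j < n) y j `^ q.
  rewrite -(perm_big _ (permEl (perm_sort leT s))) /= (big_nth 0) big_mkord.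
  by apply: eq_bigr => j _; rewrite /y /q powR_nr.
have -> : (Num.sqrt k * w) `^ p = k `^ q * w `^ p.
  by rewrite powRM ?sqrtr_ge0 // -powR12_sqrt ?(ltW k0) // -powRrM [2^-1 * p]mulrC.
have [R1 [lR sR RP]] := symmetric_sqrt bP cP pP.
have ot i : ons (take i s').
  by apply: (ons_sub _ _ os); [apply: take_uniq; case: os | move=> b; apply: mem_take].
(* Here [i] counts singular vectors; the sums below use [i.+1], the number of terms from [y 0] to
   [y i]. *)
have [h1 hh1] := choice (fun i => gap_positive (ot i) (proj1 lR) sR RP).
have [h2 hh2] := choice (fun i => gap_symmetric (ot i) sS).
have st i : (i < n)%N -> size (take i.+1 s') = i.+1 by move=> ?; apply: size_takel.
have [BP sBP] := singular_basis_exists bP cP; have [BS sBS] := singular_basis_exists bS cS.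
have L1 : k * (\sum_(i < n) (weight q y n i - weight q y n i.+1) *
    \sum_(x <- h1 i.+1) nsq (P x)) <= 1%:R * (\sum_(j < n) (1 - q^-1) * y j `^ q) +
    k `^ q * (w `^ p) / q.
  apply: (weighted_ky_fan (h := fun i => h1 i.+1) p2 erefl bP cP sBP hP y0 yd _ _ (ltW k0)).
    by move=> i; case: (hh1 i.+1).
  by move=> i ln; case: (hh1 i.+1) => _ + _; rewrite st // mul1n.
(* Raised to the power [q], the factor [2^(1/q)] doubles the term in [w], matching the factor 2 due
   to families twice as long. *)
have k20 : 0 <= 2 `^ q^-1 * k by rewrite mulr_ge0 ?powR_ge0 // ltW.
have L2 : 2 `^ q^-1 * k * (\sum_(i < n) (weight q y n i - weight q y n i.+1) *
    \sum_(x <- h2 i.+1) nsq (S x)) <= 2%:R * (\sum_(j < n) (1 - q^-1) * y j `^ q) +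
    (2 `^ q^-1 * k) `^ q * (w `^ p) / q.
  apply: (weighted_ky_fan (h := fun i => h2 i.+1) p2 erefl bS cS sBS hS y0 yd _ _ k20).
    by move=> i; case: (hh2 i.+1).
  by move=> i ln; case: (hh2 i.+1) => _ + _; rewrite st.
set sigma := \sum_(j < n) y j `^ q.
set G1 := \sum_(i < n) _ * _ in L1.
set G2 := \sum_(i < n) _ * _ in L2.
have sigmaE : sigma <= G1 + G2.
  have -> : sigma = \sum_(i < n) (weight q y n i - weight q y n i.+1) * \sum_(j < i.+1) y j.
    rewrite abel_sum {2}/weight ltnn mul0r subr0; apply: eq_bigr => j _.
    by rewrite /weight ltn_ord mulrC mulr_powRB1.
  rewrite -big_split /=; apply: ler_sum => i _; rewrite -mulrDr.
  rewrite ler_wpM2l ?subr_ge0 ?weight_homo //.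
  have -> : \sum_(j < i.+1) y j = \sum_(e <- take i.+1 s') nsq (T e).
    rewrite [RHS](big_nth 0) st // big_mkord; apply: eq_bigr => j _.
    by rewrite nth_take.
  apply: le_trans (gap_cartesian (ot _) sP sS TE) _.
  by case: (hh1 i.+1) => _ _ a; case: (hh2 i.+1) => _ _ b; apply: lerD.
move: L1 L2; rewrite -mulr_sumr -/sigma -/G1 -/G2 mul1r.
rewrite powRM ?powR_ge0 ?(ltW k0) // -powRrM mulVf ?gt_eqF // powRr1 // => L1 L2.
(* The origin of the constant [2^(1 - 2/p)]: it is the cost, relative to [P], of the doubled
   families for [S]. *)
have cE : c * 2 `^ q^-1 = 2.
  rewrite /c -powRD; last by rewrite pnatr_eq0 implybT.
  have -> : 1 - 2 / p + q^-1 = 1 by rewrite /q invf_div subrK.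
  by rewrite powRr1.
set E := (1 - q^-1) * sigma + k `^ q * w `^ p / q.
have L2' : k * G2 <= c * E.
  have h := ler_wpM2l c0 L2; have e : c * (2 `^ q^-1 * k * G2) = 2 * (k * G2).
    by rewrite !mulrA cE.
  by rewrite e in h; rewrite -(ler_pM2l (ltr0Sn R 1)); apply: le_trans h _; rewrite /E; lra.
have kE : k * sigma <= k * E.
  apply: le_trans (ler_wpM2l (ltW k0) sigmaE) _.
  have -> : k * E = E + c * E by rewrite /k mulrDl mul1r.
  by rewrite mulrDr lerD.
move: kE; rewrite ler_pM2l // /E => kE.
have : sigma * q^-1 <= k `^ q * w `^ p * q^-1 by lra.
by rewrite ler_pM2r // invr_gt0.
Qed.

(** * Operator norm, phases and reduction to finite sums *)

Lemma operator_norm_ub A x : bop A -> nr x <= 1 -> nr (A x) <= operator_norm A.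
Proof.
move=> [lA [C C0 hC]] x1; have c1 z : (`|z| <= 1) = (nr z <= 1).
  by rewrite norm_nr -[1 in LHS]/(1%:C%C) lecR.
apply: ub_le_sup; last by exists x => //=; rewrite c1.
exists (Num.sqrt C) => _ [z /= + <-]; rewrite c1 -/(nr _) (nr_sqrt (A z)) => z1.
rewrite ler_wsqrtr //; apply: le_trans (hC z) _.
by rewrite ler_piMr // nsqE exprn_ile1 ?nr_ge0.
Qed.

Lemma operator_norm_ge0 A : bop A -> 0 <= operator_norm A.
Proof.
move=> bA; apply: le_trans (nr_ge0 (A 0)) _.
by apply: operator_norm_ub; rewrite ?nr0.
Qed.

Lemma operator_norm_le A x : bop A -> nr (A x) <= operator_norm A * nr x.
Proof.
move=> bA; have [lA _] := bA; have [->|x0] := eqVneq x 0.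
  by rewrite (linearf0 lA) nr0 mulr0.
have xn : 0 < nr x.
  rewrite lt0r nr_ge0 andbT; apply: contraNneq x0 => x0.
  by apply/eqP/nsq_eq0; rewrite nsqE x0 expr0n.
have u1 : nsq (unit_of x) = 1 by rewrite nsq_unit_of // nsqE gt_eqF ?exprn_gt0.
have : nr (A (unit_of x)) <= operator_norm A.
  by apply: operator_norm_ub; rewrite // nr_sqrt u1 sqrtr1.
rewrite (linearfZ lA) nr_sqrt nsqZ csqR sqrtrM ?sqr_ge0 // sqrtr_sqr -nr_sqrt.
by rewrite ger0_norm ?invr_ge0 ?nr_ge0 // mulrC ler_pdivrMr.
Qed.

Lemma csq_expi t : csq (expi t : R[i]) = 1.
Proof. by rewrite /csq /= cos2Dsin2. Qed.

Lemma expi0 : expi 0 = 1 :> R[i].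
Proof. by rewrite /expi cos0 sin0. Qed.

Lemma expi_npihalf : expi (- (pi / 2)) = - 'i%C :> R[i].
Proof.
by rewrite /expi cosN sinN cos_pihalf sin_pihalf; apply: eqC; rewrite !reimE //= oppr0.
Qed.

Lemma cos_piquarter : cos (pi / 4) = (Num.sqrt 2)^-1 :> R.
Proof.
have e : cos (pi / 4) = sin (pi / 4) :> R.
  by rewrite -cosBpihalf -[RHS]cosN; congr cos; field.
have p0 : 0 < cos (pi / 4) :> R.
  by apply: cos_gt0_pihalf; have := @pi_gt0 R; lra.
have := @cos2Dsin2 R (pi / 4); rewrite -e => h.
have h2 : cos (pi / 4) ^+ 2 = 2^-1 :> R by lra.
by rewrite -sqrtrV // -h2 sqrtr_sqr gtr0_norm.
Qed.

(** Rotation by [- pi / 4] brings the direction [1 + i] to the real axis, so a single phase controls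
    the sum of the real and imaginary parts. *)
Lemma Re_expi_npiquarter (c : R[i]) :
  Re c + Im c = Num.sqrt 2 * Re (expi (- (pi / 4)) * c).
Proof.
have e : sin (pi / 4) = cos (pi / 4) :> R.
  by rewrite -cosBpihalf -[RHS]cosN; congr cos; field.
rewrite /expi ReM /= cosN sinN e cos_piquarter mulNr opprK -mulrDr mulrA.
by rewrite mulfV ?mul1r // sqrtr_eq0 -ltNge.
Qed.

(** [schatten_re_le] asks for a bound on every orthonormal family, where [|c A X e| <= |A| |X e|];
    [schatten_ge] then bounds the sums for [X] by its finite norm [M]. *)
Lemma schatten_compose_le A X p t : 2 <= p -> bop A -> bop X -> ucompact X ->
  (schatten_norm p X < +oo)%E ->
  (schatten_norm p (re_operator (fun x => expi t *: (A \o X) x)) <=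
     (operator_norm A)%:E * schatten_norm p X)%E.
Proof.
move=> p2 bA bX cX fX; have p0 : 0 < p by lra.
have X0 : (0 <= schatten_norm p X)%E by exact: poweR_ge0.
case EX : (schatten_norm p X) X0 fX => [M| |] //; rewrite lee_fin => M0 _.
have hX s : ons s -> \sum_(e <- s) nr (X e) `^ p <= M `^ p.
  by apply: schatten_ge => //; rewrite EX.
have N0 := operator_norm_ge0 bA.
have bAX := bop_comp bA bX; have cAX := ucompact_compl bA cX.
apply: schatten_re_le => //; [exact: bopZ|exact: ucompactZ|exact: mulr_ge0|].
move=> s os; apply: (@le_trans _ _ (operator_norm A `^ p * \sum_(e <- s) nr (X e) `^ p)).
  rewrite mulr_sumr; apply: ler_sum => e _; rewrite -powRM ?nr_ge0 //.
  rewrite ge0_ler_powR ?nnegrE ?nr_ge0 ?mulr_ge0 ?nr_ge0 ?(ltW p0) //.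
  have -> : nr (expi t *: (A \o X) e) = nr (A (X e)).
    by rewrite !nr_sqrt nsqZ csq_expi mul1r.
  exact: operator_norm_le.
by rewrite powRM // ler_wpM2l ?powR_ge0 // hX.
Qed.

(** A finite radius is a real [w] bounding all rotated real parts at once; an infinite one makes the
    right-hand side infinite because [c > 0]. *)
Lemma schatten_radius_le X p (c : R) : 2 <= p -> bop X -> ucompact X -> 0 < c ->
  (forall w B s, 0 <= w ->
    (forall t s, ons s ->
      \sum_(e <- s) nr (re_operator (fun x => expi t *: X x) e) `^ p <= w `^ p) ->
    singular_basis X B -> fam B s -> \sum_(e <- s) nr (X e) `^ p <= (c * w) `^ p) ->
  (schatten_norm p X <= c%:E * schatten_numerical_radius p X)%E.
Proof.
move=> p2 bX cX c0 h; have p0 : 0 < p by lra.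
have ub t : (schatten_norm p (re_operator (fun x => expi t *: X x)) <=
    schatten_numerical_radius p X)%E.
  by apply: ereal_sup_ubound; exists t.
have W0 : (0 <= schatten_numerical_radius p X)%E.
  exact: le_trans (poweR_ge0 _ _) (ub 0).
case EW : (schatten_numerical_radius p X) W0 ub => [w| |] // w0 ub; last first.
  by rewrite gt0_muley ?leey // lte_fin.
rewrite lee_fin in w0; have [B sB] := singular_basis_exists bX cX.
apply: (schatten_le p0 bX cX sB); first by rewrite mulr_ge0 // ltW.
move=> s fs; apply: (h w B) => // t s' os'.
by apply: schatten_ge => //; [exact/re_operator_bop/bopZ|
  apply: re_operator_ucompact; [exact: bopZ|exact: ucompactZ]].
Qed.

End Main.

Theorem theorem6p4 (R : realType) (H : hilbertType R) (p : R) (A X : H -> H)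
    (sepH : separable H) (p2 : 2 <= p)
    (bA : bounded_operator A) (sX : schatten_class p X) (accX : accretive X) :
  (schatten_numerical_radius p (A \o X) <=
     (Num.sqrt (1 + 2 `^ (1 - 2 / p)) * operator_norm A)%:E *
     schatten_numerical_radius p X)%E /\
  (dissipative X ->
   (schatten_numerical_radius p (A \o X) <=
     (Num.sqrt 2 * operator_norm A)%:E * schatten_numerical_radius p X)%E).
Proof.
have [/bounded_operatorP bX kX fX] := sX; have cX := compact_ucompact kX.
have {}bA : bop A by apply/bounded_operatorP.
(* Both claims reduce to a bound on the Schatten norm of [X] by its own numerical radius. *)
have bound (c : R) : (schatten_norm p X <= c%:E * schatten_numerical_radius p X)%E ->
    (schatten_numerical_radius p (A \o X) <=
      (c * operator_norm A)%:E * schatten_numerical_radius p X)%E.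
  move=> hc; apply: ge_ereal_sup => _ [t _ <-].
  apply: le_trans (schatten_compose_le t p2 bA bX cX fX) _.
  by rewrite mulrC EFinM -muleA lee_wpmul2l // lee_fin operator_norm_ge0.
(* The phase 0 gives [Re X], and [- pi / 2] gives [Im X]; the sector case uses only [- pi / 4]. *)
have e1 : (fun x => expi 0 *: X x) = X by apply/funext => x; rewrite expi0 scale1r.
split=> [|disX]; apply: bound; apply: (schatten_radius_le p2 bX cX).
- by rewrite sqrtr_gt0 ltr_wpDr ?powR_ge0.
- move=> w B s w0 hw sB.
  have biX := bopZ (- 'i%C) bX; have ciX := ucompactZ (- 'i%C) cX.
  apply: (@schatten_accretive _ _ X (re_operator X)
    (re_operator (fun x => - 'i%C *: X x))) => //.
  + exact: re_operator_bop.
  + exact: re_operator_ucompact.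
  + exact: re_operator_bop.
  + exact: re_operator_ucompact.
  + exact: re_operator_symmetric.
  + by move=> x; apply: cartesianE.
  + by move=> s'; have := hw 0 s'; rewrite e1.
  + by move=> s'; have := hw (- (pi / 2)) s'; rewrite expi_npihalf.
- by rewrite sqrtr_gt0.
move=> w B s w0 hw sB; apply: (@schatten_sector _ _ X (expi (- (pi / 4))) B) => //.
- by lra.
- by move=> x; have := accX x; rewrite re_operatorE // lecR.
- move=> x; have := disX x; rewrite innerZl innerBl adjointPl // (innerJ (X x) x).
  have -> : (2 * 'i%C)^-1 = - 'i%C * (2^-1)%:C%C :> R[i].
    by rewrite invfM mulrC complexiE invCi fmorphV rmorph_nat.
  by rewrite lecE !reimE /= => /andP[_]; lra.
- exact: Re_expi_npiquarter.
- exact: hw.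
Qed.
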